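(* Let $U$ be a rotation-like operator on a complex Banach space $X$, let $\mathcal{A}$ and $\Gamma$ be the associated set of operators and subgroup of $\mathbb{T}$, let $w\in\mathcal{A}'$, and let $T=wU$ be the corresponding weighted rotation-like operator. Assume one of the following conditions. (1) Every operator from $\mathcal{A}$ is invertible and the group $\Gamma$ is of infinite order. (2) There is an $A\in\mathcal{A}$ such that $A$ is invertible and $\gamma_A$ is not a root of unity. Then the spectrum $\sigma(T)$, the essential spectra $\sigma_i(T)$, $i=1,\dots,5$, and the set $\sigma_2(T')$ are rotation invariant, where $T'$ is the Banach space adjoint of $T$.
   Context: $L(X)$ is the algebra of bounded linear operators on $X$; $\mathbb{T}=\{z\in\mathbb{C}:|z|=1\}$. A set $E\subseteq\mathbb{C}$ is rotation invariant if $\zeta E=E$ for all $\zeta\in\mathbb{T}$. An invertible operator $U\in L(X)$ is called rotation-like if there are $A\in L(X)$, $A\neq0$, and $\gamma\in\mathbb{T}$, $\gamma\ne1$, with $UAU^{-1}=\gamma A$. For such $U$ put $\mathcal{A}=\{A\in L(X)\setminus\{0\}:\ \exists\,\gamma_A\in\mathbb{T},\ UAU^{-1}=\gamma_A A\}$, $\Delta=\{\gamma_A:A\in\mathcal{A}\}$, and let $\Gamma$ be the subgroup of $\mathbb{T}$ generated by $\Delta$. $\mathcal{A}'$ is the commutant of $\mathcal{A}$ in $L(X)$. A weighted rotation-like operator is $T=wU$ with $U$ rotation-like and $w\in\mathcal{A}'$. Essential spectra of a bounded operator $S$: $S$ is semi-Fredholm ($S\in\Phi$) if its range is closed and either $\dim\ker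 S<\infty$ or $\mathrm{codim}\,R(S)<\infty$; $\Phi_+=\{S\in\Phi:\dim\ker S<\infty\}$, $\Phi_-=\{S\in\Phi:\mathrm{codim}\,R(S)<\infty\}$; $\Phi_+\cap\Phi_-$ is the set of Fredholm operators; Weyl operators are Fredholm operators with $\dim\ker S-\mathrm{codim}\,R(S)=0$. $\sigma_1(S)=\{\lambda:\lambda I-S\notin\Phi\}$, $\sigma_2(S)=\{\lambda:\lambda I-S\notin\Phi_+\}$, $\sigma_3(S)=\{\lambda:\lambda I-S\text{ is not Fredholm}\}$, $\sigma_4(S)=\{\lambda:\lambda I-S\text{ is not Weyl}\}$, and $\sigma_5(S)=\sigma(S)\setminus\{\zeta\in\mathbb{C}:$ there is a component $C$ of $\mathbb{C}\setminus\sigma_1(S)$ such that $\zeta\in C$ and $C$ meets the resolvent set of $S\}$. *)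

(* Defs.v *)
From HB Require Import structures.
From mathcomp Require Import all_boot all_order all_algebra.
From mathcomp Require Import complex.
From mathcomp Require Import all_classical all_reals all_analysis.

Set Implicit Arguments.
Unset Strict Implicit.
Unset Printing Implicit Defensive.

Import Order.TTheory GRing.Theory Num.Theory.
Import numFieldNormedType.Exports.

Local Open Scope classical_set_scope.
Local Open Scope ring_scope.
Local Open Scope complex_scope.

(* The library equips K^o with its metric for every numFieldType K, but does
   not transfer it to the concrete type R[i]. *)
HB.instance Definition _ (R : realType) := NormedModule.copy R[i] R[i]^o.

Section BoundedOperators.
Context {R : realType} {V W : normedModType R[i]}.

Definition bounded_linear (f : V -> W) : Prop :=
  linear f /\ exists M : R[i], forall x, `|f x| <= M * `|x|.

Definition bounded_linear_pred : {pred (V -> W)} :=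
  [pred f | `[< bounded_linear f >]].

Lemma bounded_linear_submod : submod_closed bounded_linear_pred.
Proof.
have fct0 x : (0 : V -> W) x = 0 by [].
have fctZD a (f g : V -> W) x : (a *: f + g) x = a *: f x + g x by [].
split=> [|a f g].
  rewrite unfold_in; apply/asboolP; split=> [k x y|].
    by rewrite !fct0 scaler0 addr0.
  by exists 0 => x; rewrite fct0 normr0 mul0r.
rewrite !unfold_in => /asboolP[lf [M fM]] /asboolP[lg [N gN]].
apply/asboolP; split=> [k x y|].
  by rewrite !fctZD lf lg !scalerDr !scalerA (mulrC a) addrACA.
exists (`|a| * M + N) => x; rewrite fctZD mulrDl.
by rewrite (le_trans (ler_normD _ _))// lerD// normrZ -mulrA ler_wpM2l.
Qed.

HB.instance Definition _ :=
  GRing.isSubmodClosed.Build R[i] (V -> W) bounded_linear_pred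
    bounded_linear_submod.

End BoundedOperators.

Record blop (R : realType) (V W : normedModType R[i]) := BLop {
  blop_fun :> V -> W;
  blopP : blop_fun \in bounded_linear_pred }.

Section BoundedOperatorSpace.
Context {R : realType} {V W : normedModType R[i]}.

HB.instance Definition _ := [isSub for @blop_fun R V W].
HB.instance Definition _ := [Choice of blop V W by <:].
HB.instance Definition _ := [SubChoice_isSubLmodule of blop V W by <:].

Lemma blop_bounded_linear (f : blop V W) : bounded_linear f.
Proof. by case: f => f /=; rewrite unfold_in => /asboolP. Qed.

Lemma blop_ext (f g : blop V W) : (forall x, f x = g x) -> f = g.
Proof. by move=> fg; apply/val_inj/funext. Qed.

Lemma blop_linear (f : blop V W) : linear f.
Proof. by have [] := blop_bounded_linear f. Qed.

HB.instance Definition _ (f : blop V W) :=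
  GRing.isLinear.Build R[i] V W _ f (blop_linear f).

Definition blop_norm (f : blop V W) : R[i] :=
  (sup [set complex.Re `|f x| | x in [set x : V | `|x| <= 1]])%:C.

Lemma complex_norm_Re (U : normedModType R[i]) (x : U) :
  (complex.Re `|x|)%:C = `|x|.
Proof. by exact/RRe_real/ger0_real. Qed.

Lemma blop_norm_has_sup (f : blop V W) :
  has_sup [set complex.Re `|f x| | x in [set x : V | `|x| <= 1]].
Proof.
have [_ [M fM]] := blop_bounded_linear f.
split; first by exists (complex.Re `|f 0|), 0; rewrite //= normr0 ler01.
exists (complex.Re `|M|) => _ [x x1 <-].
rewrite -lecR complex_norm_Re RRe_real ?ger0_real// (le_trans (fM x))//.
have [->|x0] := eqVneq x 0; first by rewrite normr0 mulr0.
have xp : 0 < `|x| by rewrite normr_gt0.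
have M0 : 0 <= M.
  by have := le_trans (normr_ge0 _) (fM x); rewrite pmulr_lge0.
by rewrite ger0_norm// ler_piMr.
Qed.

Lemma blop_norm_ub (f : blop V W) (x : V) : `|x| <= 1 -> `|f x| <= blop_norm f.
Proof.
move=> x1; rewrite -complex_norm_Re lecR.
by apply: sup_upper_bound; [exact: blop_norm_has_sup|exists x].
Qed.

Lemma blop_norm_lub (f : blop V W) (M : R[i]) :
  (forall x, `|x| <= 1 -> `|f x| <= M) -> blop_norm f <= M.
Proof.
move=> fM.
have M0 : 0 <= M.
  by apply: le_trans (fM 0 _); rewrite ?normr0 ?ler01.
rewrite -[M]RRe_real ?ger0_real// lecR.
apply: ge_sup; first by have [] := blop_norm_has_sup f.
by move=> _ [x /= x1 <-]; rewrite -lecR complex_norm_Re RRe_real ?ger0_real// fM.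
Qed.

Lemma blop_norm_ge0 (f : blop V W) : 0 <= blop_norm f.
Proof. by apply: le_trans (blop_norm_ub f (x := 0) _); rewrite ?normr0 ?ler01. Qed.

Lemma blop_normP (f : blop V W) (x : V) : `|f x| <= blop_norm f * `|x|.
Proof.
have [->|x0] := eqVneq x 0; first by rewrite linear0 !normr0 mulr0.
have xp : 0 < `|x| by rewrite normr_gt0.
rewrite -ler_pdivrMr// mulrC -[X in X * _](ger0_norm (x := `|x|^-1)) ?invr_ge0//.
rewrite -normrZ -linearZ; apply: blop_norm_ub.
by rewrite normrZ normfV normr_id mulVf// normr_eq0.
Qed.

Lemma blop_norm_triangle (f g : blop V W) :
  blop_norm (f + g) <= blop_norm f + blop_norm g.
Proof.
apply: blop_norm_lub => x x1.
by rewrite (le_trans (ler_normD _ _))// lerD// blop_norm_ub.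
Qed.

Lemma blop_normZ (a : R[i]) (f : blop V W) :
  blop_norm (a *: f) = `|a| * blop_norm f.
Proof.
have le b (g : blop V W) : blop_norm (b *: g) <= `|b| * blop_norm g.
  apply: blop_norm_lub => x x1.
  by rewrite [X in `|X|](_ : _ = b *: g x)// normrZ ler_wpM2l// blop_norm_ub.
have [->|a0] := eqVneq a 0.
  apply/le_anti; rewrite le/= normr0 mul0r; exact: blop_norm_ge0.
apply/le_anti; rewrite le/= -ler_pdivlMl ?normr_gt0// -normfV.
by rewrite -[f in leLHS]scale1r -(mulVf a0) -scalerA le.
Qed.

Lemma blop_norm_eq0 (f : blop V W) : blop_norm f = 0 -> f = 0.
Proof.
move=> f0; apply: blop_ext => x; apply/normr0_eq0/le_anti.
by rewrite normr_ge0 andbT (le_trans (blop_normP f x))// f0 mul0r.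
Qed.

HB.instance Definition _ := Lmodule_isNormed.Build R[i] (blop V W)
  blop_norm_triangle blop_normZ blop_norm_eq0.

End BoundedOperatorSpace.

Section OperatorAlgebra.
Context {R : realType} {V : normedModType R[i]}.

Lemma bounded_linear_id : (@idfun V) \in bounded_linear_pred.
Proof.
rewrite unfold_in; apply/asboolP; split=> [a x y //|].
by exists 1 => x; rewrite mul1r.
Qed.

Lemma bounded_linear_comp (W Z : normedModType R[i]) (f : blop W Z)
  (g : blop V W) : (f \o g) \in bounded_linear_pred.
Proof.
rewrite unfold_in; apply/asboolP; split=> [a x y /=|]; first by rewrite !linearP.
exists (blop_norm f * blop_norm g) => x /=.
rewrite (le_trans (blop_normP f _))// -mulrA ler_wpM2l ?blop_normP//.
exact: blop_norm_ge0.
Qed.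

Definition blop_comp (W Z : normedModType R[i]) (f : blop W Z) (g : blop V W) :
  blop V Z := BLop (bounded_linear_comp f g).

Lemma blop_compZDl (W Z : normedModType R[i]) (a : R[i]) (f g : blop W Z)
  (h : blop V W) :
  blop_comp (a *: f + g) h = a *: blop_comp f h + blop_comp g h.
Proof. exact: blop_ext. Qed.

Definition blop_id : blop V V := BLop bounded_linear_id.

Lemma blop_compA : associative (fun f g : blop V V => blop_comp f g).
Proof. by move=> f g h; exact: blop_ext. Qed.

Lemma blop_comp1l : left_id blop_id (fun f g : blop V V => blop_comp f g).
Proof. by move=> f; exact: blop_ext. Qed.

Lemma blop_comp1r : right_id blop_id (fun f g : blop V V => blop_comp f g).
Proof. by move=> f; exact: blop_ext. Qed.

Lemma blop_compDl :
  left_distributive (fun f g : blop V V => blop_comp f g) +%R.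
Proof. by move=> f g h; exact: blop_ext. Qed.

Lemma blop_compDr :
  right_distributive (fun f g : blop V V => blop_comp f g) +%R.
Proof. by move=> f g h; apply: blop_ext => x; exact: linearD. Qed.

(* L(V), with composition as product; V may be the zero space, so this ring is
   not required to be nontrivial and has no unitRingType structure. *)
HB.instance Definition _ := GRing.Zmodule_isPzRing.Build (blop V V)
  blop_compA blop_comp1l blop_comp1r blop_compDl blop_compDr.

End OperatorAlgebra.

Notation "''L' ( V )" := (blop V V) (at level 8, format "''L' ( V )").

Definition dual_space (R : realType) (V : normedModType R[i]) :
  normedModType R[i] := blop V R[i].

Section Adjoint.
Context {R : realType} {V : normedModType R[i]}.

Lemma bounded_linear_adjoint (T : 'L(V)) :
  (fun phi : dual_space V => blop_comp phi T : dual_space V)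
    \in bounded_linear_pred.
Proof.
rewrite unfold_in; apply/asboolP; split=> [a f g|]; first exact: blop_compZDl.
exists `|T| => phi; apply: blop_norm_lub => x x1 /=.
rewrite (le_trans (blop_normP phi _))// mulrC ler_wpM2r ?blop_norm_ge0//.
exact: blop_norm_ub.
Qed.

(* the Banach space adjoint phi |-> phi \o T, linear (not conjugate-linear)
   in T *)
Definition adjoint (T : 'L(V)) : 'L(dual_space V) :=
  BLop (bounded_linear_adjoint T).

End Adjoint.

Section Dimension.
Context {K : fieldType} {V : lmodType K}.

Definition has_dim (E : set V) (n : nat) : Prop :=
  exists e : 'I_n -> V, (forall i, E (e i)) /\
    forall x, E x -> exists! c : 'rV[K]_n, x = \sum_(i < n) c 0 i *: e i.

(* the classes of some n vectors form a basis of the quotient V / E *)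
Definition has_codim (E : set V) (n : nat) : Prop :=
  exists e : 'I_n -> V,
    forall x, exists! c : 'rV[K]_n, E (x - \sum_(i < n) c 0 i *: e i).

Definition fin_dim (E : set V) : Prop := exists n, has_dim E n.

Definition fin_codim (E : set V) : Prop := exists n, has_codim E n.

End Dimension.

Section Spectra.
Context {R : realType} {V : normedModType R[i]}.
Implicit Types S : 'L(V).

Definition inverse_of S : set 'L(V) := [set Q | S * Q = 1 /\ Q * S = 1].

Definition invertible S : Prop := inverse_of S !=set0.

Definition opinv S : 'L(V) := xget 0 (inverse_of S).

Definition op_ker S : set V := [set x | S x = 0].

Definition semi_fredholm S : Prop :=
  closed (range S) /\ (fin_dim (op_ker S) \/ fin_codim (range S)).

Definition upper_semi_fredholm S : Prop :=
  semi_fredholm S /\ fin_dim (op_ker S).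

Definition lower_semi_fredholm S : Prop :=
  semi_fredholm S /\ fin_codim (range S).

Definition fredholm S : Prop :=
  upper_semi_fredholm S /\ lower_semi_fredholm S.

Definition has_index S (k : int) : Prop :=
  exists n m : nat,
    [/\ has_dim (op_ker S) n, has_codim (range S) m & k = n%:Z - m%:Z].

Definition weyl S : Prop := fredholm S /\ has_index S 0.

Definition pencil (z : R[i]) S : 'L(V) := z *: (1 : 'L(V)) - S.

Definition spectrum S : set R[i] := [set z | ~ invertible (pencil z S)].

Definition resolvent_set S : set R[i] := ~` spectrum S.

Definition ess_spectrum1 S : set R[i] :=
  [set z | ~ semi_fredholm (pencil z S)].

Definition ess_spectrum2 S : set R[i] :=
  [set z | ~ upper_semi_fredholm (pencil z S)].

Definition ess_spectrum3 S : set R[i] := [set z | ~ fredholm (pencil z S)].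

Definition ess_spectrum4 S : set R[i] := [set z | ~ weyl (pencil z S)].

Definition is_component (D C : set R[i]) : Prop :=
  exists2 z, D z & C = connected_component D z.

Definition ess_spectrum5 S : set R[i] :=
  spectrum S `\` [set z | exists C : set R[i],
    [/\ is_component (~` ess_spectrum1 S) C, C z &
        C `&` resolvent_set S !=set0]].

End Spectra.

Section RotationLike.
Context {R : realType} {V : normedModType R[i]}.
Implicit Types U A : 'L(V).

Definition unit_circle : set R[i] := [set z | `|z| = 1].

Definition rotation_invariant (E : set R[i]) : Prop :=
  forall zeta, unit_circle zeta -> [set zeta * z | z in E] = E.

Definition rotation_factor U A : set R[i] :=
  [set g | unit_circle g /\ U * A * opinv U = g *: A].

Definition rotation_like U : Prop :=
  invertible U /\
  exists A g, [/\ A != 0, g != 1 & rotation_factor U A g].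

Definition rotated U : set 'L(V) :=
  [set A | A != 0 /\ rotation_factor U A !=set0].

(* gamma_A; for A in [rotated U] the factor exists and, as A != 0, is unique *)
Definition gamma U A : R[i] := xget 1 (rotation_factor U A).

Definition Delta U : set R[i] := gamma U @` rotated U.

Definition circle_subgroup (H : set R[i]) : Prop :=
  [/\ H `<=` unit_circle, H 1 & forall x y, H x -> H y -> H (x / y)].

Definition Gamma U : set R[i] := smallest circle_subgroup (Delta U).

Definition commutant (E : set 'L(V)) : set 'L(V) :=
  [set B | forall A, E A -> B * A = A * B].

Definition is_root_of_unity (z : R[i]) : Prop :=
  exists2 n, (0 < n)%N & n.-unity_root z.

End RotationLike.

(* Main.v *)
Require Import Defs.
From HB Require Import structures.
From mathcomp Require Import all_boot all_order all_algebra.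
From mathcomp Require Import complex ring lra.
From mathcomp Require Import all_classical all_reals all_analysis.
Import Order.TTheory GRing.Theory Num.Theory.
Import numFieldNormedType.Exports.
Local Open Scope classical_set_scope.
Local Open Scope ring_scope.
Local Open Scope complex_scope.
Set Implicit Arguments.
Unset Strict Implicit.
Unset Printing Implicit Defensive.

(** Write T = w U. If A is an invertible operator with U A U^-1 = gamma A, then
T A = gamma A T because w commutes with A, so T is similar to gamma T, and every
set of scalars z defined by a similarity-invariant property of z - T is stable
under multiplication by gamma. The unimodular gamma that arise from invertible
intertwiners form a subgroup of the circle ([circle_subgroup_factors]); either
hypothesis makes it infinite ([infinite_intertwining_factors]), and an infinite
subgroup of the circle is dense ([infinite_circle_subgroup_dense]). A closed set
stable under a dense group of rotations is stable under all of them. Hence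
everything rests on the spectra being closed, that is, on the invertible,
semi-Fredholm, Fredholm and Weyl operators forming open sets.

Openness comes from descriptions of these classes by inequalities. An operator S
is upper semi-Fredholm exactly when it is bounded below up to finitely many
bounded functionals ([upper_semi_fredholmP]), and lower semi-Fredholm exactly
when S x = y can be solved with control of x up to an error in a fixed
finite-dimensional space ([lower_semi_fredholmP]). The first estimate survives
small perturbations by the triangle inequality, the second by successive
approximation ([iterated_solution]). The descriptions need the open mapping
theorem, in a version relative to a closed subspace ([open_mapping]), and
Hahn-Banach separation ([Hahn_Banach_separation]), which makes finite extensions
of closed subspaces closed and provides functionals dual to a basis of the
kernel. An operator of index zero becomes invertible after adding a finite-rank
operator; conversely a finite-rank perturbation of an invertible operator has
index zero, since its kernel and cokernel are those of a square matrix
([has_index0_of_invertible_perturbation]). So the Weyl operators are open as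
well ([norm_open_weyl]).

The fifth essential spectrum is obtained from the spectrum and the first
essential spectrum through connected components, which rotations permute
([rotation_invariant_ess_spectrum5]). For the adjoint of T the intertwiners are
the adjoints of the inverses of the A, and the dual space is complete
([blop_banach]). *)

(** * Real-valued norms, closedness and completeness *)

(** Norms take values in the partially ordered field R[i]; their real parts
live in a totally ordered field, where estimates can be closed by linear
arithmetic. *)
Definition nr (R : realType) (V : normedModType R[i]) (x : V) : R :=
  complex.Re `|x|.

Section RealNorm.
Context {R : realType} {V : normedModType R[i]}.
Implicit Types (x y z : V) (a : R[i]).

Lemma nrE x : (nr x)%:C = `|x|.
Proof. exact: (complex_norm_Re x). Qed.

Lemma nr_ge0 x : 0 <= nr x.
Proof. by rewrite -lecR nrE normr_ge0. Qed.

Lemma nr0 : nr (0 : V) = 0.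
Proof. by rewrite /nr normr0. Qed.

Lemma nr_eq0 x : nr x = 0 -> x = 0.
Proof. by move=> x0; apply/normr0_eq0; rewrite -nrE x0. Qed.

Lemma nrN x : nr (- x) = nr x.
Proof. by rewrite /nr normrN. Qed.

Lemma nrBC x y : nr (x - y) = nr (y - x).
Proof. by rewrite -nrN opprB. Qed.

Lemma nrD x y : nr (x + y) <= nr x + nr y.
Proof. by rewrite -lecR rmorphD /= !nrE ler_normD. Qed.

Lemma nrB x y : nr (x - y) <= nr x + nr y.
Proof. by rewrite -(nrN y) nrD. Qed.

Lemma nr_dist x y z : nr (x - z) <= nr (x - y) + nr (y - z).
Proof. by rewrite (le_trans _ (nrD _ _))// addrA subrK. Qed.

Lemma nr_gt0 x : x <> 0 -> 0 < nr x.
Proof. by move=> x0; rewrite lt_neqAle nr_ge0 andbT eq_sym; apply/eqP => /nr_eq0. Qed.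

Lemma nrZ a x : nr (a *: x) = nr a * nr x.
Proof. by apply: complexI; rewrite rmorphM /= !nrE normrZ. Qed.

End RealNorm.

Section ComplexNorm.
Context {R : realType}.

Lemma nrC (r : R) : nr r%:C = `|r|.
Proof. by rewrite /nr normc_def /= expr0n addr0 sqrtr_sqr. Qed.

Lemma nr_norm (a : R[i]) : (nr a)%:C = `|a|.
Proof. exact: nrE. Qed.

Lemma nrM (a b : R[i]) : nr (a * b) = nr a * nr b.
Proof. exact: nrZ. Qed.

Lemma Re_nr (a : R[i]) : `|complex.Re a| <= nr a.
Proof.
rewrite -lecR nr_norm normc_def lecR -[leLHS]sqrtr_sqr ler_wsqrtr//.
by rewrite lerDl sqr_ge0.
Qed.

Lemma Im_nr (a : R[i]) : `|complex.Im a| <= nr a.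
Proof.
rewrite -lecR nr_norm normc_def lecR -[leLHS]sqrtr_sqr ler_wsqrtr//.
by rewrite lerDr sqr_ge0.
Qed.

Lemma nr_ReIm (a : R[i]) : nr a <= `|complex.Re a| + `|complex.Im a|.
Proof.
rewrite -lecR nr_norm normc_def lecR -[leRHS]ger0_norm ?addr_ge0//.
rewrite -[leRHS]sqrtr_sqr ler_wsqrtr//.
rewrite sqrrD !real_normK ?num_real// addrAC lerDl mulrn_wge0//.
Qed.
End ComplexNorm.

(** Completeness, tested on sequences with geometrically decreasing steps; the
explicit rate turns limits into estimates. As a property rather than a
structure it applies directly to a dual space. *)
Definition banach (R : realType) (V : normedModType R[i]) : Prop :=
  forall (u : nat -> V) (M : R),
    (forall k, nr (u k.+1 - u k) <= M * 2^-1 ^+ k) ->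
    exists x, forall k, nr (x - u k) <= 2 * M * 2^-1 ^+ k.

Section Closed.
Context {R : realType} {V : normedModType R[i]}.

Lemma nbhs_nr (x : V) (E : set V) :
  nbhs x E <-> exists2 e : R, 0 < e & forall y, nr (x - y) < e -> E y.
Proof.
rewrite -nbhs_ballE; split=> [[e /= e0 xE]|[e e0 xE]].
  have eE : (complex.Re e)%:C = e by rewrite RRe_real ?gtr0_real.
  exists (complex.Re e); first by rewrite -ltcR eE.
  by move=> y xy; apply: xE; rewrite -ball_normE /ball_/= -nrE -eE ltcR.
exists e%:C => /=; first by rewrite ltcR.
by move=> y; rewrite -ball_normE /ball_/= -nrE ltcR => /xE.
Qed.

Lemma closure_nrP (E : set V) (y : V) : closure E y <->
  forall e : R, 0 < e -> exists2 z, E z & nr (y - z) < e.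
Proof.
split=> cE => [e e0|B /nbhs_nr[e e0 eB]].
  have /cE[z [Ez yz]] : nbhs y [set z | nr (y - z) < e].
    by apply/nbhs_nr; exists e.
  by exists z.
by have [z Ez yz] := cE e e0; exists z; split=> //; exact: eB.
Qed.

Lemma closed_nrP (L : set V) : closed L <->
  forall y, (forall e : R, 0 < e -> exists2 z, L z & nr (y - z) < e) -> L y.
Proof. by split=> cL y Ly; apply: cL; exact/closure_nrP. Qed.

Lemma closed_set0 : closed [set (0 : V)].
Proof.
apply/closed_nrP => y y0; apply: contrapT => /nr_gt0 yp.
by have [_ -> ] := y0 _ yp; rewrite subr0 ltxx.
Qed.

End Closed.

Section Geometric.
Context {R : realType}.

Lemma half_exp_gt0 k : 0 < 2^-1 ^+ k :> R.
Proof. by rewrite exprn_gt0// invr_gt0. Qed.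

(** Stated for an arbitrary subadditive N, to serve both the absolute value of
reals and [nr]. *)
Lemma telescope_half (V : zmodType) (N : V -> R) (u : nat -> V) (M : R) :
    N 0 = 0 -> (forall x, 0 <= N x) -> (forall x y, N (x + y) <= N x + N y) ->
    (forall k, N (u k.+1 - u k) <= M * 2^-1 ^+ k) ->
  forall k j, N (u (k + j)%N - u k) <= 2 * M * 2^-1 ^+ k.
Proof.
move=> N0 N_ge0 ND uM k j.
have M0 : 0 <= M by have := uM 0%N; rewrite mulr1; apply: le_trans.
suff : N (u (k + j)%N - u k) <= 2 * M * 2^-1 ^+ k * (1 - 2^-1 ^+ j).
  move=> /le_trans; apply; rewrite ler_piMr//.
  by rewrite !mulr_ge0// ltW// half_exp_gt0.
elim: j => [|j IH]; first by rewrite addn0 subrr N0 expr0 subrr mulr0.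
rewrite addnS -(subrK (u (k + j)%N) (u _.+1)) -addrA.
rewrite (le_trans (ND _ _))// (le_trans (lerD (uM _) IH))//.
rewrite exprD exprS; set a := _ ^+ k; set b := _ ^+ j.
by rewrite le_eqVlt; apply/orP; left; apply/eqP; field.
Qed.

(** The limit is the supremum of the lower ends of the nested intervals of
radius 2M/2^k around r k. *)
Lemma real_geometric_limit (r : nat -> R) (M : R) :
    (forall k, `|r k.+1 - r k| <= M * 2^-1 ^+ k) ->
  exists x, forall k, `|x - r k| <= 2 * M * 2^-1 ^+ k.
Proof.
move=> rM.
have M0 : 0 <= M by have := rM 0%N; rewrite mulr1; apply: le_trans.
have tl := telescope_half (normr0 R) (@normr_ge0 _ R) (@ler_normD _ R) rM.
have up k j : r j - 2 * M * 2^-1 ^+ j <= r k + 2 * M * 2^-1 ^+ k.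
  have pk i : 0 <= 2 * M * 2^-1 ^+ i by rewrite !mulr_ge0// ltW// half_exp_gt0.
  have [kj|/ltnW jk] := leqP k j.
    have := tl k (j - k)%N; rewrite subnKC// => /ler_normlP[_].
    by have := pk j; lra.
  have := tl j (k - j)%N; rewrite subnKC// => /ler_normlP[+ _].
  by have := pk k; lra.
exists (sup [set r k - 2 * M * 2^-1 ^+ k | k in [set: nat]]) => k.
have ub : has_ubound [set r k - 2 * M * 2^-1 ^+ k | k in [set: nat]].
  by exists (r 0%N + 2 * M * 2^-1 ^+ 0) => _ [j _ <-].
rewrite ler_norml; apply/andP; split.
  by rewrite lerBrDl; apply: ub_le_sup => //; exists k.
rewrite lerBlDl; apply: ge_sup; first by exists (r 0%N - 2 * M * 2^-1 ^+ 0), 0%N.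
by move=> _ [j _ <-].
Qed.
Lemma half_expD_le k j : 2^-1 ^+ (k + j) <= 2^-1 ^+ j :> R.
Proof.
rewrite exprD; apply: ler_piMl; first by rewrite ltW// half_exp_gt0.
by apply: exprn_ile1; rewrite ?invr_ge0// invf_le1// ler1n.
Qed.
End Geometric.

Section Banach.
Context {R : realType}.

Lemma half_exp_small (e M : R) : 0 < e -> exists k, M * 2^-1 ^+ k < e.
Proof.
move=> e0.
have [k] : exists k : nat, M / e < k%:R.
  by exists (Num.truncn (M / e)).+1; rewrite truncnS_gt.
rewrite ltr_pdivrMr// => Mk; exists k.
rewrite exprVn ltr_pdivrMr ?exprn_gt0// (lt_le_trans Mk)// mulrC ler_wpM2l ?ltW//.
by rewrite -natrX ltr_nat ltn_expl.
Qed.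

Lemma le0_half_exp (r M : R) : (forall k, r <= M * 2^-1 ^+ k) -> r <= 0.
Proof.
move=> rM; rewrite leNgt; apply/negP => r0.
by have [k] := half_exp_small M r0; rewrite ltNge rM.
Qed.

(** The steps are summable, so the sequence is Cauchy; its limit inherits the
rate from the telescoped bound. *)
Lemma complete_banach (V : completeNormedModType R[i]) : banach V.
Proof.
move=> u M uM.
have tl := telescope_half (@nr0 R V) (@nr_ge0 R V) (@nrD R V) uM.
have cu : cauchy (u @ \oo).
  apply/cauchy_ballP => e e0.
  have eE : (complex.Re e)%:C = e by rewrite RRe_real ?gtr0_real.
  have [k kM] : exists k, 2 * (2 * M) * 2^-1 ^+ k < complex.Re e.
    by apply: half_exp_small; rewrite -ltcR eE.
  exists ([set u j | j in [set j | (k <= j)%N]], [set u j | j in [set j | (k <= j)%N]]).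
    by split; exists k => // j /= kj; exists j.
  move=> [_ _] /= [[i ki <-] [j kj <-]].
  rewrite -ball_normE /ball_/= -nrE -eE ltcR (le_lt_trans (nr_dist _ (u k) _))//.
  have := tl k (i - k)%N; have := tl k (j - k)%N.
  rewrite !subnKC// (nrBC (u j)); lra.
have /cauchy_cvgP := cu; set x := lim _ => ux.
(* compare x with a term of the sequence so late that it is e-close to x *)
exists x => k; apply/ler_addgt0Pl => e e0.
have /ux[N _ NU] : nbhs x [set y | nr (x - y) < e] by apply/nbhs_nr; exists e.
have := NU (k + N)%N; rewrite /= leq_addl => /(_ isT) xk.
by rewrite (le_trans (nr_dist _ (u (k + N)%N) _))// lerD// ltW.
Qed.

Lemma complex_banach : banach (R[i] : normedModType R[i]).
Proof.
move=> u M uM.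
have [a ua] : exists x, forall k, `|x - complex.Re (u k)| <= 2 * M * 2^-1 ^+ k.
  apply: real_geometric_limit => k.
  by rewrite (le_trans _ (uM k))// -raddfB Re_nr.
have [b ub] : exists x, forall k, `|x - complex.Im (u k)| <= 2 * M * 2^-1 ^+ k.
  apply: real_geometric_limit => k.
  by rewrite (le_trans _ (uM k))// -raddfB Im_nr.
have tl := telescope_half (@nr0 R R[i]) (@nr_ge0 R R[i]) (@nrD R R[i]) uM.
exists (a +i* b) => k; apply/ler_addgt0Pl => e e0.
have [N NM] := half_exp_small (2 * (2 * M)) e0.
have M0 : 0 <= M by have := uM 0%N; rewrite mulr1; apply: le_trans (nr_ge0 _).
apply: le_trans (nr_dist _ (u (k + N)%N) _) _; rewrite lerD//.
apply: le_trans (nr_ReIm _) _.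
rewrite !raddfB /= (le_trans (lerD (ua _) (ub _)))//.
apply: le_trans (ltW NM).
by have := ler_wpM2l M0 (half_expD_le k N); lra.
Qed.
End Banach.

Section BlopLinear.
Context {R : realType} {V W : normedModType R[i]}.
Implicit Types (f : blop V W) (x y : V).

Lemma blop0 f : f 0 = 0. Proof. exact: linear0. Qed.

Lemma blopD f x y : f (x + y) = f x + f y. Proof. exact: linearD. Qed.

Lemma blopB f x y : f (x - y) = f x - f y. Proof. exact: linearB. Qed.

Lemma blopZ f a x : f (a *: x) = a *: f x. Proof. exact: linearZ_LR. Qed.

Lemma blop_sum f (I : Type) (r : seq I) (P : pred I) (F : I -> V) :
  f (\sum_(i <- r | P i) F i) = \sum_(i <- r | P i) f (F i).
Proof. exact: linear_sum. Qed.

Lemma blop_addE (f g : blop V W) x : (f + g) x = f x + g x.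
Proof. by []. Qed.
End BlopLinear.

Section Operators.
Context {R : realType} {V W : normedModType R[i]}.

Lemma nr_blop (f : blop V W) (x : V) : nr (f x) <= nr f * nr x.
Proof. by rewrite -lecR rmorphM /= !nrE blop_normP. Qed.

Lemma nr_blop_le (f : blop V W) (M : R) :
  0 <= M -> (forall x, nr (f x) <= M * nr x) -> nr f <= M.
Proof.
move=> M0 fM; rewrite -lecR nrE; apply: blop_norm_lub => x.
rewrite -!nrE -[1]/(1%:C) !lecR => x1.
by rewrite (le_trans (fM x))// ler_piMr.
Qed.

Lemma bounded_linear_nr (f : V -> W) (M : R) :
  linear f -> (forall x, nr (f x) <= M * nr x) -> f \in bounded_linear_pred.
Proof.
move=> lf fM; rewrite unfold_in; apply/asboolP; split=> //.
by exists M%:C => x; rewrite -!nrE -rmorphM lecR.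
Qed.

(** Limits are taken pointwise in W; linearity, boundedness and the rate of
norm convergence all pass to the pointwise limit. *)
Lemma blop_banach : banach W -> banach (blop V W).
Proof.
move=> bW u M uM.
have M0 : 0 <= M by have := uM 0%N; rewrite mulr1; apply: le_trans (nr_ge0 _).
have /choice[f fu] : forall x, exists y,
    forall k, nr (y - u k x) <= 2 * (M * nr x) * 2^-1 ^+ k.
  move=> x; apply: bW => k.
  by rewrite mulrAC (le_trans (nr_blop (u k.+1 - u k) x))// ler_wpM2r ?nr_ge0.
have lf : linear f.
  move=> a x y; apply/subr0_eq/nr_eq0/le_anti; rewrite nr_ge0 andbT.
  apply: (@le0_half_exp _ _ (2 * (M * nr (a *: x + y)) +
     nr a * (2 * (M * nr x)) + 2 * (M * nr y))) => k.
  have -> : f (a *: x + y) - (a *: f x + f y) =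
      (f (a *: x + y) - u k (a *: x + y)) - a *: (f x - u k x) - (f y - u k y).
    rewrite scalerBr -[RHS]addrA -opprD (addrACA (a *: f x)) -opprD.
    by rewrite [in RHS]opprB (blop_linear (u k)) addrA subrK.
  rewrite (le_trans (nrB _ _))// !(mulrDl _ _ (_ ^+ k)); apply: lerD => //.
  rewrite (le_trans (nrB _ _))//; apply: lerD => //.
  by rewrite nrZ -mulrA ler_wpM2l// nr_ge0.
have fM x : nr (f x) <= (2 * M + nr (u 0%N)) * nr x.
  rewrite -[f x](subrK (u 0%N x)) (le_trans (nrD _ _))// mulrDl lerD ?nr_blop//.
  by have := fu x 0%N; rewrite mulr1 mulrA.
exists (BLop (bounded_linear_nr lf fM)) => k; apply: nr_blop_le.
  by rewrite !mulr_ge0// ltW// half_exp_gt0.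
by move=> x; have := fu x k; rewrite mulrA mulrAC.
Qed.
End Operators.

(** * Baire category and the open mapping theorem *)

Definition lsubspace (R : realType) (V : normedModType R[i]) (E : set V) : Prop :=
  E 0 /\ forall (a : R[i]) x y, E x -> E y -> E (a *: x + y).

Section Subspaces.
Context {R : realType} {V : normedModType R[i]}.
Implicit Types (E : set V) (x y : V).

Lemma lsubspaceD E x y : lsubspace E -> E x -> E y -> E (x + y).
Proof. by move=> [_ EZ] Ex Ey; rewrite -[x]scale1r; exact: EZ. Qed.

Lemma lsubspaceZ E a x : lsubspace E -> E x -> E (a *: x).
Proof. by move=> [E0 EZ] Ex; rewrite -[_ *: _]addr0; exact: EZ. Qed.

Lemma lsubspaceN E x : lsubspace E -> E x -> E (- x).
Proof. by move=> lE Ex; rewrite -scaleN1r; exact: lsubspaceZ. Qed.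

Lemma lsubspaceB E x y : lsubspace E -> E x -> E y -> E (x - y).
Proof. by move=> lE Ex Ey; apply: lsubspaceD => //; exact: lsubspaceN. Qed.

Lemma lsubspace_set0 : lsubspace [set (0 : V)].
Proof. by split=> // a _ _ -> ->; rewrite /= scaler0 addr0. Qed.

Lemma lsubspaceT : lsubspace [set: V].
Proof. by []. Qed.

End Subspaces.

Lemma lsubspace_range (R : realType) (V W : normedModType R[i]) (S : blop V W) :
  lsubspace (range S).
Proof.
split=> [|a _ _ [x _ <-] [y _ <-]]; first by exists 0 => //; rewrite linear0.
by exists (a *: x + y) => //; rewrite linearP.
Qed.

Section Baire.
Context {R : realType} {V : normedModType R[i]}.

(** Baire's theorem inside a closed subset L of a Banach space: if no A k
contained a ball of L, points of L avoiding A 0, A 1, ... successively, at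
quickly decreasing mutual distances, would converge to a point of L outside
every A k. Relativizing to L allows it to be used in the closed range of an
operator. *)
Lemma relative_Baire (L : set V) (A : nat -> set V) :
    banach V -> closed L -> L !=set0 -> (forall k, closed (A k)) ->
    L `<=` \bigcup_k A k ->
  exists k y (d : R),
    [/\ 0 < d, L y & forall z, L z -> nr (z - y) < d -> A k z].
Proof.
move=> bV cL [y0 Ly0] cA LA; apply: contrapT => noball.
pose good (p : V * R) := L p.1 /\ 0 < p.2.
have /choice[next nextP] : forall kp : nat * (V * R), exists q : V * R,
    good kp.2 -> [/\ good q, nr (q.1 - kp.2.1) <= kp.2.2,
      q.2 <= kp.2.2 * 2^-1 &
      forall z, nr (z - q.1) <= 2 * q.2 -> ~ A kp.1 z].
  move=> [k [y d]] /=; have [[/= Ly d0]|ng] := pselect (good (y, d)); last first.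
    by exists (y, d) => g; case: ng.
  have [z [Lz zy nAz]] : exists z, [/\ L z, nr (z - y) < d & ~ A k z].
    apply: contrapT => noz; apply: noball; exists k, y, d; split=> // z Lz zy.
    by apply: contrapT => nAz; apply: noz; exists z.
  have [r r0 rA] : exists2 r : R, 0 < r & forall z', nr (z' - z) < r -> ~ A k z'.
    apply: contrapT => nor; apply: nAz; move/closed_nrP: (cA k); apply => e e0.
    apply: contrapT => noz; apply: nor; exists e => // z' zz' Az'.
    by apply: noz; exists z' => //; rewrite nrBC.
  (* the limit will be within twice the radius of z, hence closer to z than r *)
  exists (z, Num.min (d * 2^-1) (r * 4^-1)) => _ /=; split.
  - by split=> //=; rewrite lt_min; apply/andP; split; lra.
  - exact: ltW.
  - by rewrite ge_min lexx.
  - move=> z' zz'; apply: rA; apply: le_lt_trans zz' _.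
    apply: (@le_lt_trans _ _ (2 * (r * 4^-1))); last by lra.
    by rewrite ler_pM2l// ge_min lexx orbT.
pose p := fix p k := if k is j.+1 then next (j, p j) else (y0, 1 : R).
have pgood k : good (p k).
  by elim: k => [|k /(nextP (k, p k))[]//]; split.
have pS k := nextP (k, p k) (pgood k).
have pd k j : (p (k + j)%N).2 <= (p k).2 * 2^-1 ^+ j.
  elim: j => [|j IH]; first by rewrite addn0 mulr1.
  rewrite addnS exprSr mulrA; have [_ _ + _] := pS (k + j)%N.
  by move/le_trans; apply; rewrite ler_wpM2r// invr_ge0.
have tl k j : nr ((p (k + j)%N).1 - (p k).1) <= 2 * (p k).2.
  have := @telescope_half R V _ (fun j => (p (k + j)%N).1) (p k).2 nr0
     (@nr_ge0 _ V) (@nrD _ V).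
  have H i : nr ((p (k + i.+1)%N).1 - (p (k + i)%N).1) <= (p k).2 * 2^-1 ^+ i.
    have [_ + _ _] := pS (k + i)%N; rewrite addnS => /le_trans; apply.
    exact: pd.
  by move=> /(_ H 0%N j); rewrite add0n addn0 mulr1.
have [x xp] : exists x, forall k, nr (x - (p k).1) <= 2 * 1 * 2^-1 ^+ k.
  apply: bV => k; have [_ + _ _] := pS k => /le_trans; apply.
  exact: (pd 0%N k).
have xp2 k : nr (x - (p k).1) <= 2 * (p k).2.
  rewrite -subr_le0; apply: (le0_half_exp (M := 2)) => j.
  have := nr_dist x (p (k + j)%N).1 (p k).1; have := tl k j.
  have := xp (k + j)%N; rewrite mulr1.
  by have := half_expD_le (R := R) k j; lra.
have Lx : L x.
  move/closed_nrP: cL; apply=> e e0; have [k ke] := half_exp_small (2 * 1) e0.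
  by exists (p k).1; [have [] := pgood k|exact: le_lt_trans ke].
have [k _ Ax] := LA x Lx.
by have [_ _ _ /(_ x (xp2 k.+1))] := pS k.
Qed.

End Baire.

Section OpenMapping.
Context {R : realType} {V W : normedModType R[i]}.

(** Successive approximation: if every equation S x = y modulo F can be solved
up to an error at most half of y, then solving again for the error and summing
the corrections gives an exact solution. It closes the proof of the open
mapping theorem, and it shows that a quantitative surjectivity modulo F
survives a small perturbation of S. *)
Lemma iterated_solution (S : blop V W) (F L : set W) (K : R) :
    banach V -> lsubspace F -> closed F -> 0 <= K ->
    (forall y, L y -> exists x y1,
       [/\ L y1, F (y - y1 - S x), nr x <= K * nr y & nr y1 <= nr y * 2^-1]) ->
  forall y, L y -> exists2 x, F (y - S x) & nr x <= 2 * K * nr y.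
Proof.
move=> bV lF cF K0 step y Ly.
have /choice[g gP] : forall z, exists p : V * W, L z ->
    [/\ L p.2, F (z - p.2 - S p.1), nr p.1 <= K * nr z & nr p.2 <= nr z * 2^-1].
  move=> z; have [Lz|nLz] := pselect (L z); last by exists (0, 0).
  by have [x [y1 H]] := step z Lz; exists (x, y1).
pose p := fix p k := if k is j.+1 then ((p j).1 + (g (p j).2).1, (g (p j).2).2)
  else (0, y).
have Lp k : L (p k).2 by elim: k => [//|k /gP[]].
have pS k := gP _ (Lp k).
have py k : nr (p k).2 <= nr y * 2^-1 ^+ k.
  elim: k => [|k IH]; first by rewrite mulr1.
  have [_ _ _ /le_trans] := pS k; apply.
  by rewrite exprSr mulrA ler_wpM2r// invr_ge0.
have pF k : F (y - (p k).2 - S (p k).1).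
  elim: k => [|k IH] /=; first by rewrite subrr linear0 subr0; case: lF.
  have [_ Fk _ _] := pS k; have := lsubspaceD lF IH Fk.
  congr F; rewrite (linearD S) opprD addrACA; congr (_ + _).
  by rewrite addrA subrK.
have [x xp] : exists x, forall k, nr (x - (p k).1) <= 2 * (K * nr y) * 2^-1 ^+ k.
  apply: bV => k /=; rewrite addrAC subrr add0r.
  by have [_ _ /le_trans + _] := pS k; apply; rewrite -mulrA ler_wpM2l.
exists x; last by have := xp 0%N; rewrite subr0 mulr1 mulrA.
move/closed_nrP: cF; apply=> e e0.
have [k ke] := half_exp_small (nr y + nr S * (2 * (K * nr y))) e0.
exists (y - (p k).2 - S (p k).1) => //; apply: le_lt_trans ke.
have -> : y - S x - (y - (p k).2 - S (p k).1) = (p k).2 - S (x - (p k).1).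
  rewrite (linearB S) -(addrA y (- (p k).2)) -opprD [- (y - _)]opprB [LHS]addrC.
  by rewrite subrKA opprB addrA.
rewrite (le_trans (nrB _ _))// mulrDl lerD// (le_trans (nr_blop _ _))//.
by rewrite -mulrA ler_wpM2l// nr_ge0.
Qed.

(** The open mapping theorem for surjectivity of S onto L modulo F. With F = 0
and L the range of S it says that an operator with closed range has a bounded
(nonlinear) right inverse there; with L the whole space and F finite
dimensional it handles ranges of finite codimension. By Baire, approximate
solutions of norm at most k exist near some point of L; subtracting and
rescaling gives approximate solutions everywhere, which [iterated_solution]
makes exact. *)
Lemma open_mapping (S : blop V W) (F L : set W) :
    banach V -> banach W -> lsubspace F -> closed F -> lsubspace L -> closed L ->
    F `<=` L -> range S `<=` L -> (forall y, L y -> exists x, F (y - S x)) ->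
  exists2 K : R, 0 <= K &
    forall y, L y -> exists2 x, F (y - S x) & nr x <= K * nr y.
Proof.
move=> bV bW lF cF lL cL FL SL onto.
pose B k := [set y | exists2 x, F (y - S x) & nr x <= k%:R].
have [k [y0 [d [d0 Ly0 ballB]]]] : exists k y (d : R),
    [/\ 0 < d, L y & forall z, L z -> nr (z - y) < d -> closure (B k) z].
  apply: relative_Baire => //; first by exists 0; case: lL.
    by move=> k; exact: closed_closure.
  move=> y /onto[x Fx]; exists (Num.truncn (nr x)).+1 => //.
  by apply: subset_closure; exists x => //; rewrite ltW// truncnS_gt.
(* 4 k / d = 2 k / (d / 2): differences of two solutions of norm at most k,
   for right-hand sides of norm d / 2 *)
exists (2 * (4 * k%:R / d)); first by rewrite !mulr_ge0// invr_ge0 ltW.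
apply: iterated_solution => //; first by rewrite !mulr_ge0// invr_ge0 ltW.
move=> y Ly; have [->|/eqP/nr_gt0 yp] := eqVneq y 0.
  exists 0, 0; rewrite (linear0 S) !subr0 !nr0 mulr0 mul0r; split=> //.
  - by case: lL.
  - by case: lF.
pose t := d / (2 * nr y); have t0 : 0 < t by rewrite divr_gt0// mulr_gt0.
have tC : t%:C != 0 :> R[i] by rewrite -[0]/(0%:C) (inj_eq (@complexI _)) gt_eqF.
have nrt (U : normedModType R[i]) (x : U) : nr (t%:C *: x) = t * nr x.
  by rewrite nrZ nrC gtr0_norm.
have nrtV (U : normedModType R[i]) (x : U) : nr (t%:C^-1 *: x) = t^-1 * nr x.
  apply: (mulfI (lt0r_neq0 t0)); rewrite -nrt scalerA divff// scale1r.
  by rewrite mulrA divff ?mul1r// lt0r_neq0.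
have tyd : t * nr y = d / 2 by rewrite /t; field; rewrite gt_eqF.
have Lz : L (y0 + t%:C *: y) by apply: lsubspaceD => //; exact: lsubspaceZ.
have d8 : 0 < d / 8 by rewrite divr_gt0.
have /closure_nrP/(_ _ d8)[z1 [x1 Fx1 x1k] zz1] : closure (B k) (y0 + t%:C *: y).
  by apply: ballB => //; rewrite addrAC subrr add0r nrt tyd; lra.
have /closure_nrP/(_ _ d8)[z0 [x0 Fx0 x0k] zz0] : closure (B k) y0.
  by apply: ballB => //; rewrite subrr nr0.
pose x := t%:C^-1 *: (x1 - x0); pose y' := t%:C^-1 *: (z1 - z0).
have Fy' : F (y' - S x).
  rewrite /y' /x linearZ_LR -scalerBr; apply: lsubspaceZ => //.
  have := lsubspaceB lF Fx1 Fx0; congr F.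
  by rewrite (linearB S) !opprB addrACA [RHS]addrACA [- z0 - _]addrC.
exists x, (y - y'); split.
- apply: lsubspaceB => //; rewrite -[y'](subrK (S x)); apply: lsubspaceD => //.
    exact: FL.
  by apply: SL; exists x.
- by rewrite opprB addrCA subrr addr0.
- rewrite /x nrtV.
  have -> : 4 * k%:R / d * nr y = t^-1 * (k%:R + k%:R).
    by rewrite /t; field; rewrite !gt_eqF.
  by rewrite ler_pM2l ?invr_gt0// (le_trans (nrB _ _))// lerD.
- rewrite -[y in nr (y - _)](scalerK tC) -scalerBr nrtV mulrC ler_pdivrMr//.
  rewrite mulrAC (mulrC (nr y)) tyd.
  have -> : t%:C *: y - (z1 - z0) = (y0 + t%:C *: y - z1) - (y0 - z0).
    by rewrite !opprB -(addrA y0) [RHS]addrC subrKA addrCA.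
  by have := nrB (y0 + t%:C *: y - z1) (y0 - z0); lra.
Qed.

End OpenMapping.

(** * The Hahn-Banach theorem *)

Section HahnBanach.
Context {R : realType} {V : normedModType R[i]}.

(** The graph of a real-linear functional on a real subspace, bounded by M
times the norm. Single-valuedness need not be imposed: a linear relation with
this bound relates 0 only to 0. *)
Definition dominated_graph (M : R) (G : set (V * R)) : Prop :=
  (forall t p q, G p -> G q -> G (t%:C *: p.1 + q.1, t * p.2 + q.2)) /\
  forall p, G p -> p.2 <= M * nr p.1.

(** The value c at x0 must lie between all p.2 - M * nr (p.1 - x0) and all M *
nr (q.1 + x0) - q.2; by the triangle inequality the former never exceed the
latter, so their supremum is a legitimate choice. *)
Lemma dominated_graph_extend M G x0 : 0 <= M ->
    G (0, 0) -> dominated_graph M G ->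
  exists G', [/\ G `<=` G', dominated_graph M G' & exists c, G' (x0, c)].
Proof.
move=> M0 G0 [Glin Gdom].
pose lower := [set p.2 - M * nr (p.1 - x0) | p in G].
have lower_le q : G q -> forall s, lower s -> s <= M * nr (q.1 + x0) - q.2.
  move=> Gq _ [p Gp <-]; have := Gdom _ (Glin 1 p q Gp Gq).
  rewrite /= scale1r mul1r.
  have : M * nr (p.1 + q.1) <= M * nr (p.1 - x0) + M * nr (q.1 + x0).
    rewrite -mulrDr ler_wpM2l//; apply: le_trans (nrD _ _).
    by rewrite addrACA addNr addr0.
  lra.
pose c := sup lower.
have lower0 : lower !=set0 by exists (0 - M * nr (0 - x0)), (0, 0).
have hasub : has_ubound lower.
  by exists (M * nr (0 + x0) - 0); exact: (lower_le (0, 0)).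
have c_ge p : G p -> p.2 - M * nr (p.1 - x0) <= c.
  by move=> Gp; apply: ub_le_sup => //; exists p.
have c_le q : G q -> c <= M * nr (q.1 + x0) - q.2.
  by move=> Gq; apply: ge_sup => //; exact: lower_le.
have Gscale t q : G q -> G (t%:C *: q.1, t * q.2).
  by move=> Gq; have := Glin t q _ Gq G0; rewrite /= !addr0.
have scale_out s (x : V) : 0 < s -> nr x = s * nr (s^-1%:C *: x).
  move=> s0; rewrite nrZ nrC gtr0_norm ?invr_gt0// mulrA divff ?mul1r//.
  by rewrite gt_eqF.
have VscaleK s : 0 < s -> s^-1%:C *: (s%:C *: x0) = x0.
  by move=> s0; rewrite scalerA -rmorphM mulVf ?gt_eqF// scale1r.
exists [set p | exists q t, G q /\ p = (q.1 + t%:C *: x0, q.2 + t * c)]; split.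
- by move=> [x r] Gp; exists (x, r), 0; rewrite scale0r mul0r !addr0.
- split=> [t _ _ [p [a [Gp ->]]] [q [b [Gq ->]]]|_ [q [t [Gq ->]]]] /=.
    exists (t%:C *: p.1 + q.1, t * p.2 + q.2), (t * a + b).
    split; first exact: Glin.
    congr (_, _) => /=; last by ring.
    by rewrite scalerDr rmorphD rmorphM scalerDl scalerA addrACA.
  have [t0|t0|<-] := ltgtP 0 t.
  + rewrite (scale_out t)// scalerDr VscaleK// mulrCA.
    have := ler_wpM2l (ltW t0) (c_le _ (Gscale t^-1 q Gq)).
    by rewrite /= mulrBr mulVKf ?gt_eqF//; lra.
  + have s0 : 0 < - t by rewrite oppr_gt0.
    have -> : t%:C *: x0 = - ((- t)%:C *: x0) by rewrite rmorphN scaleNr opprK.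
    rewrite (scale_out (- t))// scalerBr VscaleK// mulrCA.
    have := ler_wpM2l (ltW s0) (c_ge _ (Gscale (- t)^-1 q Gq)).
    by rewrite /= mulrBr mulVKf ?gt_eqF//; lra.
  + by rewrite scale0r mul0r !addr0; exact: Gdom.
- by exists c, (0, 0), 1; rewrite scale1r mul1r !add0r.
Qed.

(** Zorn's lemma, with the maximum sought among the sets A whose union with G0
is a dominated graph: in this form the empty chain needs no separate
treatment. *)
Lemma dominated_graph_total M G0 : 0 <= M ->
    G0 (0, 0) -> dominated_graph M G0 ->
  exists G, [/\ G0 `<=` G, dominated_graph M G & forall x, exists r, G (x, r)].
Proof.
move=> M0 G00 domG0.
have [F FP Ftot|A [domA maxA]] := @Zorn_bigcup _
    [set A | dominated_graph M (G0 `|` A)].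
  pose mem X := X = set0 \/ F X.
  have FI p : (G0 `|` \bigcup_(X in F) X) p -> exists2 X, mem X & (G0 `|` X) p.
    move=> [G0p|[X FX Xp]]; first by exists set0; left.
    by exists X; right.
  have FE X p : mem X -> (G0 `|` X) p -> (G0 `|` \bigcup_(X in F) X) p.
    move=> mX [G0p|Xp]; [by left|right].
    by case: mX Xp => [->//|FX] Xp; exists X.
  have domX X : mem X -> dominated_graph M (G0 `|` X).
    by move=> [->|/FP//]; rewrite setU0.
  split=> [t p q /FI[X mX Xp] /FI[Y mY Yq]|p /FI[X /domX[_ Xdom] /Xdom//]].
  have [XY|YX] : X `<=` Y \/ Y `<=` X.
    move: mX mY => [->|FX] [->|FY]; [left|left|right|exact: Ftot] => //.
  - apply: (FE Y) => //; have [Ylin _] := domX Y mY; apply: Ylin => //.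
    by apply: setUS Xp.
  - apply: (FE X) => //; have [Xlin _] := domX X mX; apply: Xlin => //.
    by apply: setUS Yq.
exists (G0 `|` A); split=> // x.
have [|G' [AG' domG' [c G'c]]] := @dominated_graph_extend M (G0 `|` A) x M0 _ domA.
  by left.
have G0G' : G0 `|` G' = G' by apply/setUidPr => p G0p; apply: AG'; left.
exists c; right; apply: contrapT => nA; apply: (maxA G'); last by rewrite /= G0G'.
by split=> [|G'A]; [move=> p Ap; apply: AG'; right|exact/nA/G'A].
Qed.

Lemma real_Hahn_Banach M G0 : 0 <= M -> G0 (0, 0) -> dominated_graph M G0 ->
  exists u : V -> R, [/\ forall t x y, u (t%:C *: x + y) = t * u x + u y,
    forall x, `|u x| <= M * nr x & forall x r, G0 (x, r) -> u x = r].
Proof.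
move=> M0 G00 domG0.
have [G [G0G [Glin Gdom] Gtot]] := dominated_graph_total M0 G00 domG0.
have Gfun x r s : G (x, r) -> G (x, s) -> r = s.
  move=> Gr Gs; apply/le_anti/andP; split.
    have := Gdom _ (Glin (-1) _ _ Gs Gr); rewrite /= rmorphN scaleN1r addNr.
    by rewrite nr0; lra.
  have := Gdom _ (Glin (-1) _ _ Gr Gs); rewrite /= rmorphN scaleN1r addNr.
  by rewrite nr0; lra.
have /choice[u Gu] := Gtot.
have ulin t x y : u (t%:C *: x + y) = t * u x + u y.
  apply: Gfun; first exact: Gu.
  exact: (Glin t (x, u x) (y, u y)).
exists u; split=> // [x|x r G0x]; last by apply: Gfun (Gu x) _; exact: G0G.
rewrite ler_norml; apply/andP; split; last exact: (Gdom (x, u x)).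
have := Gdom _ (Gu (- x)); rewrite /= nrN.
have := ulin (-1) x 0; rewrite addr0 rmorphN scaleN1r => ->.
have := ulin 1 0 0; rewrite scaler0 addr0; lra.
Qed.

(** On L + Cv the map x + a v |-> a is bounded by the inverse of the distance
d from v to L. Its real part u extends to the whole space, and the complex
functional is recovered as u x - i u(i x). *)
Lemma Hahn_Banach_separation (L : set V) (v : V) :
    lsubspace L -> closed L -> ~ L v ->
  exists phi : blop V R[i], (forall x, L x -> phi x = 0) /\ phi v = 1.
Proof.
move=> lL cL nLv.
have [d d0 dL] : exists2 d : R, 0 < d & forall x, L x -> d <= nr (v - x).
  apply: contrapT => nd; apply: nLv; move/closed_nrP: cL; apply=> e e0.
  apply: contrapT => nz; apply: nd; exists e => // x Lx.
  by rewrite leNgt; apply/negP => vx; apply: nz; exists x.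
have M0 : 0 <= d^-1 by rewrite invr_ge0 ltW.
pose G0 := [set p : V * R | exists x a, L x /\ p = (x + a *: v, complex.Re a)].
have G00 : G0 (0, 0).
  by exists 0, 0; split; [case: lL|rewrite scale0r addr0].
have domG0 : dominated_graph d^-1 G0.
  split=> [t _ _ [x [a [Lx ->]]] [y [b [Ly ->]]]|_ [x [a [Lx ->]]]] /=.
    exists (t%:C *: x + y), (t%:C * a + b).
    split; first by have [_] := lL; apply.
    rewrite scalerDr scalerDl scalerA addrACA; congr (_, _).
    by rewrite raddfD /=; case: a => a1 a2 /=; rewrite mul0r subr0.
  rewrite ler_pdivlMl//; have [->|a0] := eqVneq a 0.
    by rewrite mulr0 nr_ge0.
  apply: (@le_trans _ _ (nr a * d)).
    rewrite mulrC; apply: ler_wpM2r; first exact: ltW.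
    exact: le_trans (ler_norm _) (Re_nr _).
  have -> : x + a *: v = a *: (v - (- (a^-1 *: x))).
    by rewrite opprK scalerDr scalerA divff// scale1r addrC.
  rewrite nrZ ler_wpM2l ?nr_ge0//; apply: dL.
  by apply: lsubspaceN => //; exact: lsubspaceZ.
have [u [ulin uM uG]] := real_Hahn_Banach M0 G00 domG0.
have uL x a : L x -> u (x + a *: v) = complex.Re a.
  by move=> Lx; apply: uG; exists x, a.
have u0 : u 0 = 0 by apply: uG.
have uD x y : u (x + y) = u x + u y by have := ulin 1 x y; rewrite scale1r mul1r.
have uZ t x : u (t%:C *: x) = t * u x by have := ulin t x 0; rewrite u0 !addr0.
(* the only complex-linear functional with real part u *)
pose phi x := u x +i* - u ('i *: x).
have phiM x : nr (phi x) <= (2 * d^-1) * nr x.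
  apply: (le_trans (nr_ReIm _)); rewrite /= normrN.
  have := uM ('i *: x); have := uM x; rewrite nrZ.
  have -> : nr ('i : R[i]) = 1 by apply: complexI; rewrite nr_norm normCi.
  lra.
have philin : linear (phi : V -> R[i]).
  move=> [s t] x y.
  have st z : (s +i* t) *: z = s%:C *: z + t%:C *: ('i *: z).
    rewrite scalerA -scalerDl; congr (_ *: _); apply/eqP.
    by rewrite eq_complex /=; apply/andP; split; apply/eqP; ring.
  have ist z : 'i *: ((s +i* t) *: z) = s%:C *: ('i *: z) + (- t)%:C *: z.
    rewrite !scalerA -scalerDl; congr (_ *: _); apply/eqP.
    by rewrite eq_complex /=; apply/andP; split; apply/eqP; ring.
  apply/eqP; rewrite eq_complex /phi scalerDr ist st /= !uD !uZ.
  by apply/andP; split; apply/eqP; ring.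
exists (BLop (bounded_linear_nr philin phiM)); split=> [x Lx|] /=; rewrite /phi.
  have uL0 y : L y -> u y = 0.
    by move=> Ly; have := uL y 0 Ly; rewrite scale0r addr0.
  by rewrite !uL0// ?oppr0//; exact: lsubspaceZ.
have L0 : L 0 by case: lL.
have := uL 0 1 L0; have := uL 0 'i L0; rewrite !add0r scale1r => -> ->.
by rewrite /= oppr0.
Qed.

End HahnBanach.

(** * Finite extensions of closed subspaces *)

Section Spans.
Context {R : realType} {V : normedModType R[i]}.
Implicit Types (E F : set V) (x y v : V) (l : seq V).

Definition adjoin E v : set V := [set y | exists a : R[i], E (y - a *: v)].

Definition span_over E l : set V := foldr (fun v F => adjoin F v) E l.

Lemma sub_adjoin E v : E `<=` adjoin E v.
Proof. by move=> y Ey; exists 0; rewrite scale0r subr0. Qed.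

Lemma lsubspace_adjoin E v : lsubspace E -> lsubspace (adjoin E v).
Proof.
move=> lE; split=> [|a x y [b Ex] [c Ey]]; first exact/sub_adjoin/lE.1.
exists (a * b + c); have := lE.2 a _ _ Ex Ey; congr E.
by rewrite scalerBr scalerDl scalerA opprD addrACA.
Qed.

Lemma mem_adjoin E v : lsubspace E -> adjoin E v v.
Proof. by move=> lE; exists 1; rewrite scale1r subrr; exact: lE.1. Qed.

Lemma adjoin_id E v : lsubspace E -> E v -> adjoin E v = E.
Proof.
move=> lE Ev; apply/seteqP; split=> [y [a Ey]|]; last exact: sub_adjoin.
by rewrite -[y](subrK (a *: v)); apply: lsubspaceD => //; exact: lsubspaceZ.
Qed.

(** With phi vanishing on E and equal to 1 at v, the set E + Cv is the inverse
image of E under the bounded map y |-> y - phi y *: v. *)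
Lemma closed_adjoin E v : lsubspace E -> closed E -> closed (adjoin E v).
Proof.
move=> lE cE; have [Ev|nEv] := pselect (E v); first by rewrite adjoin_id.
have [phi [phiE phiv]] := Hahn_Banach_separation lE cE nEv.
apply/closed_nrP => y yE; exists (phi y); move/closed_nrP: cE; apply => e e0.
pose M := 1 + nr phi * nr v.
have M0 : 0 < M by rewrite ltr_pwDl// mulr_ge0 ?nr_ge0.
(* the map y |-> y - phi y *: v has norm at most M *)
have [z [a]] := yE (e / M) (divr_gt0 e0 M0); set w := z - _ => Ew yz.
exists w => //; have -> : y - phi y *: v - w = (y - z) - phi (y - z) *: v.
  have -> : phi (y - z) = phi y - a.
    have : phi (z - a *: v) = 0 by exact: phiE.
    rewrite !blopB blopZ phiv => /subr0_eq ->.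
    by congr (_ - _); exact: mulr1.
  rewrite /w scalerBl !opprB addrACA [RHS]addrACA; congr (_ + _).
  by rewrite [RHS]addrC.
rewrite (le_lt_trans (nrB _ _))// nrZ.
apply: (@le_lt_trans _ _ (nr (y - z) * M)); last by rewrite -ltr_pdivlMr.
rewrite /M mulrDr mulr1 lerD2l mulrA ler_wpM2r ?nr_ge0//.
by rewrite mulrC nr_blop.
Qed.

Lemma lsubspace_span E l : lsubspace E -> lsubspace (span_over E l).
Proof. by move=> lE; elim: l => //= v l; exact: lsubspace_adjoin. Qed.

Lemma closed_span E l : lsubspace E -> closed E -> closed (span_over E l).
Proof.
move=> lE cE; elim: l => //= v l; apply: closed_adjoin; exact: lsubspace_span.
Qed.

Lemma subset_span_over E l : E `<=` span_over E l.
Proof. by elim: l => //= v l IH; apply: subset_trans IH _; exact: sub_adjoin. Qed.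

Lemma mem_span E l v : lsubspace E -> v \in l -> span_over E l v.
Proof.
move=> lE; elim: l => //= w l IH; rewrite inE => /predU1P[->|/IH vl].
  exact/mem_adjoin/lsubspace_span.
exact: sub_adjoin.
Qed.

Lemma lsubspace_sum E (I : Type) (r : seq I) (P : pred I) (e : I -> V) :
  lsubspace E -> (forall i, P i -> E (e i)) -> E (\sum_(i <- r | P i) e i).
Proof.
move=> lE eE; elim/big_rec: _ => [|i y Pi]; first exact: lE.1.
by apply: lsubspaceD => //; exact: eE.
Qed.

Lemma lsubspaceI E F : lsubspace E -> lsubspace F -> lsubspace (E `&` F).
Proof.
move=> lE lF; split=> [|a x y [Ex Fx] [Ey Fy]]; first by split; [exact: lE.1|exact: lF.1].
by split; [exact: lE.2|exact: lF.2].
Qed.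

(** A subspace of F + Cv that is not contained in F meets F in a hyperplane,
so one vector w outside F completes it. *)
Lemma hyperplane_adjoin E F v : lsubspace E -> lsubspace F ->
  E `<=` adjoin F v -> ~ E `<=` F -> exists2 w, E w & E = adjoin (E `&` F) w.
Proof.
move=> lE lF Ev /existsNP[w /not_implyP[Ew nFw]]; exists w => //.
have [a Fa] := Ev w Ew.
have a0 : a != 0.
  by apply/eqP => a0; apply: nFw; move: Fa; rewrite a0 scale0r subr0.
apply/seteqP; split=> [y Ey|y [b [Eb _]]]; last first.
  by rewrite -[y](subrK (b *: w)); apply: lsubspaceD => //; exact: lsubspaceZ.
have [b Fb] := Ev y Ey; exists (b / a); split.
  by apply: lsubspaceB => //; exact: lsubspaceZ.
have := lsubspaceB lF Fb (lsubspaceZ (b / a) lF Fa); congr F.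
by rewrite scalerBr scalerA divfK// opprB addrA subrK.
Qed.

Lemma sub_finite_span E l : lsubspace E -> E `<=` span_over [set 0] l ->
  exists l', E = span_over [set 0] l'.
Proof.
elim: l E => [|v l IH] E lE El.
  exists [::]; apply/seteqP; split=> // _ ->; exact: lE.1.
have lF := lsubspace_span l (@lsubspace_set0 _ V).
have [EF|nEF] := pselect (E `<=` span_over [set 0] l); first exact: IH.
have [w Ew ->] := hyperplane_adjoin lE lF El nEF.
have [l' ->] := IH _ (lsubspaceI lE lF) (@subIsetr _ _ _).
by exists (w :: l').
Qed.

Lemma closed_sub_finite_span E l :
  lsubspace E -> E `<=` span_over [set 0] l -> closed E.
Proof.
move=> lE /(sub_finite_span lE)[l' ->].
by apply: closed_span; [exact: lsubspace_set0|exact: closed_set0].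
Qed.

Lemma span_over_coord E (I : finType) (e : I -> V) (s : seq I) y :
  span_over E [seq e i | i <- s] y ->
  exists2 c : I -> R[i], (forall i, i \notin s -> c i = 0) &
    E (y - \sum_i c i *: e i).
Proof.
elim: s y => [|i s IH] y /=.
  by exists (fun=> 0) => //; rewrite big1 ?subr0// => i _; rewrite scale0r.
move=> [a /IH[c cs cE]]; exists (fun j => c j + (if j == i then a else 0)).
  move=> j; rewrite inE negb_or => /andP[/negbTE -> /cs ->]; exact: addr0.
move: cE; congr E; rewrite -addrA -opprD; congr (_ - _).
under [RHS]eq_bigr do rewrite scalerDl; rewrite big_split /= addrC; congr (_ + _).
rewrite (bigD1 i)//= eqxx big1 ?addr0// => j /negbTE ->; exact: scale0r.
Qed.

(** Add the vectors of l one at a time and drop those already in the span. *)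
Lemma span_over_basis F l : lsubspace F -> exists n (e : 'I_n -> V),
  (forall i, span_over F l (e i)) /\
  forall x, span_over F l x ->
    exists! c : 'rV[R[i]]_n, F (x - \sum_(i < n) c 0 i *: e i).
Proof.
move=> lF; elim: l => [|v l [n [e [eE eU]]]] /=.
  exists 0, (fun=> 0); split=> [_|x Fx]; first exact: lF.1.
  exists 0; split=> [|c _]; first by rewrite big_ord0 subr0.
  by apply/rowP => -[].
have lE := lsubspace_span l lF.
have [Ev|nEv] := pselect (span_over F l v).
  by rewrite adjoin_id//; exists n, e.
pose e' (i : 'I_n.+1) := if unlift ord0 i is Some j then e j else v.
have sumE (c : 'rV[R[i]]_n.+1) : \sum_i c 0 i *: e' i =
    c 0 ord0 *: v + \sum_(j < n) (\row_j c 0 (lift ord0 j)) 0 j *: e j.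
  rewrite big_ord_recl {1}/e' unlift_none; congr (_ + _).
  by apply: eq_bigr => j _; rewrite mxE /e' liftK.
exists n.+1, e'; split=> [i|x [a Ea]].
  by rewrite /e'; case: unliftP => [j|] _; [exact: sub_adjoin|exact: mem_adjoin].
have [c0 [c0F c0U]] := eU _ Ea.
exists (\row_i if unlift ord0 i is Some j then c0 0 j else a); split=> [|c].
  rewrite sumE opprD addrA mxE unlift_none.
  move: c0F; congr (F (_ - _)); apply: eq_bigr => j _.
  by rewrite !mxE liftK.
rewrite sumE opprD addrA => cF.
have Ec : span_over F l (x - c 0 ord0 *: v).
  rewrite -[_ - _](subrK (\sum_(j < n) (\row_j c 0 (lift ord0 j)) 0 j *: e j)).
  apply: lsubspaceD => //; first exact: subset_span_over.
  by apply: lsubspace_sum => // j _; exact: lsubspaceZ.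
have ac : a = c 0 ord0.
  apply/eqP; apply: contrapT => /negP ac; apply: nEv.
  have := lsubspaceB lE Ec Ea; rewrite opprB addrC addrA subrK -scalerBl.
  move/(lsubspaceZ (a - c 0 ord0)^-1 lE).
  by rewrite scalerA mulVf ?scale1r// subr_eq0.
rewrite -ac in cF; have c0c := c0U _ cF.
apply/rowP => i; rewrite mxE; case: unliftP => [j ->|-> //].
by rewrite c0c mxE.
Qed.

Lemma fin_dim_span l : fin_dim (span_over [set 0] l).
Proof.
have [n [e [eE eU]]] := span_over_basis l (@lsubspace_set0 _ V).
exists n, e; split=> // x /eU[c [/= /subr0_eq xc cU]]; exists c; split=> // d xd.
by apply: cU; rewrite /= -xd subrr.
Qed.

Lemma fin_codim_span F l : lsubspace F -> span_over F l = [set: V] -> fin_codim F.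
Proof.
move=> lF FT; have [n [e [eE eU]]] := span_over_basis l lF.
by exists n, e => x; apply: eU; rewrite FT.
Qed.

Lemma quotient_basis_span F n (e : 'I_n -> V) : lsubspace F ->
  (forall x, exists c : 'rV[R[i]]_n, F (x - \sum_(i < n) c 0 i *: e i)) ->
  forall x, exists2 z, span_over [set 0] [seq e i | i <- enum 'I_n] z & F (x - z).
Proof.
move=> lF Fe x; have [c Fc] := Fe x; exists (\sum_(i < n) c 0 i *: e i) => //.
have lS := lsubspace_span [seq e i | i <- enum 'I_n] (@lsubspace_set0 _ V).
apply: lsubspace_sum => // i _; apply: lsubspaceZ => //.
by apply: mem_span; [exact: lsubspace_set0|rewrite map_f// mem_enum].
Qed.

Lemma basis_independent E n (e : 'I_n -> V) : E 0 ->
    (forall x, E x -> exists! c : 'rV[R[i]]_n, x = \sum_(i < n) c 0 i *: e i) ->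
  forall c : 'I_n -> R[i], \sum_i c i *: e i = 0 -> forall i, c i = 0.
Proof.
move=> E0 eU c c0 i; have [d [_ dU]] := eU 0 E0.
have dc : d = \row_i c i.
  by apply: dU; rewrite -[LHS]c0; apply: eq_bigr => j _; rewrite mxE.
have d0 : d = 0 by apply: dU; rewrite big1// => j _; rewrite mxE scale0r.
by have := congr1 (fun r : 'rV_n => r 0 i) dc; rewrite d0 !mxE.
Qed.

Lemma quotient_basis_independent E n (e : 'I_n -> V) : lsubspace E ->
    (forall x, exists! c : 'rV[R[i]]_n, E (x - \sum_(i < n) c 0 i *: e i)) ->
  forall c : 'I_n -> R[i], E (\sum_i c i *: e i) -> forall i, c i = 0.
Proof.
move=> lE eU c Ec i; have [d [_ dU]] := eU (\sum_i c i *: e i).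
have dc : d = \row_i c i.
  apply: dU; under [X in _ - X]eq_bigr do rewrite mxE.
  by rewrite subrr; exact: lE.1.
have d0 : d = 0.
  by apply: dU; rewrite [X in _ - X]big1 ?subr0// => j _; rewrite mxE scale0r.
by have := congr1 (fun r : 'rV_n => r 0 i) dc; rewrite d0 !mxE.
Qed.

(** For each i, Hahn-Banach separates e i from the span of the other vectors,
which is closed because it is finite dimensional. *)
Lemma dual_family n (e : 'I_n -> V) :
    (forall c : 'I_n -> R[i], \sum_i c i *: e i = 0 -> forall i, c i = 0) ->
  exists phi : 'I_n -> blop V R[i], forall i j, phi i (e j) = (i == j)%:R.
Proof.
move=> ind.
suff /choice[phi H] : forall i, exists phi : blop V R[i],
    forall j, phi (e j) = (i == j)%:R by exists phi.
move=> i.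
have l0 := @lsubspace_set0 _ V.
pose s := [seq j <- enum 'I_n | j != i].
have [|phi [phi0 phi1]] := Hahn_Banach_separation
   (lsubspace_span [seq e j | j <- s] l0)
   (@closed_span _ [seq e j | j <- s] l0 (@closed_set0 _ V)) (v := e i).
  move=> /span_over_coord[c cs /= /eqP]; rewrite subr_eq0 => /eqP ei.
  have ci : c i = 0 by apply: cs; rewrite mem_filter eqxx.
  have := ind (fun j => c j - (j == i)%:R).
  under eq_bigr do rewrite scalerBl; rewrite sumrB -ei (bigD1 i)//= eqxx scale1r.
  rewrite big1 => [|j /negbTE ->]; last exact: scale0r.
  rewrite addr0 subrr => /(_ erefl i); rewrite ci eqxx sub0r => /eqP.
  by rewrite oppr_eq0 oner_eq0.
exists phi => j; have [<-|ij] := eqVneq i j; first by rewrite phi1.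
apply: phi0; apply: mem_span => //; rewrite map_f// mem_filter mem_enum.
by rewrite eq_sym ij.
Qed.

End Spans.

(** * Upper semi-Fredholm operators *)

Lemma nr_sum (R : realType) (V : normedModType R[i]) (I : Type) (r : seq I)
    (P : pred I) (F : I -> V) :
  nr (\sum_(i <- r | P i) F i) <= \sum_(i <- r | P i) nr (F i).
Proof.
elim/big_ind2: _ => [|x a y b xa yb|//]; first by rewrite nr0.
exact: le_trans (nrD _ _) (lerD xa yb).
Qed.

Section ClosedRange.
Context {R : realType} {V W : normedModType R[i]}.
Implicit Types (S : blop V W) (E M : set V) (q : blop V R[i]).

Lemma lsubspace_ker S : lsubspace [set x | S x = 0].
Proof.
split=> [|a x y /= Sx Sy]; first by rewrite /= blop0.
by rewrite blopD blopZ Sx Sy scaler0 addr0.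
Qed.

Lemma closed_ker S : closed [set x | S x = 0].
Proof.
apply/closed_nrP => y yS; apply: contrapT => /nr_gt0 Sy.
have e0 : 0 < nr (S y) / (nr S + 1) by rewrite divr_gt0// ltr_wpDl ?nr_ge0.
have [z /= Sz yz] := yS _ e0.
have := nr_blop S (y - z); rewrite blopB Sz subr0 leNgt => /negP; apply.
move: yz; rewrite ltr_pdivlMr ?ltr_wpDl ?nr_ge0// mulrDr mulr1 mulrC.
by apply: le_lt_trans; rewrite lerDl nr_ge0.
Qed.

Lemma lsubspace_image S E : lsubspace E -> lsubspace (S @` E).
Proof.
move=> lE; split=> [|a _ _ [x Ex <-] [y Ey <-]].
  by exists 0; [exact: lE.1|exact: blop0].
by exists (a *: x + y); [exact: lE.2|rewrite blopD blopZ].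
Qed.

Lemma image_adjoin S E v : S @` adjoin E v = adjoin (S @` E) (S v).
Proof.
apply/seteqP; split=> [_ [x [a Ex] <-]|y [a [x Ex xy]]].
  by exists a, (x - a *: v); rewrite // blopB blopZ.
exists (x + a *: v); last by rewrite blopD blopZ xy subrK.
by exists a; rewrite addrK.
Qed.

(** An operator bounded below on M pulls Cauchy sequences of the image back to
Cauchy sequences in M. *)
Lemma closed_image_bounded_below S M (K : R) :
    banach V -> lsubspace M -> closed M ->
    (forall x, M x -> nr x <= K * nr (S x)) ->
  closed (S @` M).
Proof.
move=> bV lM cM MK; apply/closed_nrP => y yS.
have /choice[u uP] : forall k : nat, exists x,
    M x /\ nr (y - S x) <= 2^-1 ^+ k.
  move=> k; have [_ [x Mx <-] yx] := yS _ (half_exp_gt0 k).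
  by exists x; rewrite ltW.
have [x xu] : exists x, forall k, nr (x - u k) <= 2 * (`|K| * 2) * 2^-1 ^+ k.
  apply: bV => k; have [Muk yuk] := uP k; have [Muk1 yuk1] := uP k.+1.
  rewrite (le_trans (MK _ (lsubspaceB lM Muk1 Muk)))//.
  rewrite (le_trans (ler_wpM2r (nr_ge0 _) (ler_norm K)))// -mulrA ler_wpM2l//.
  rewrite blopB (le_trans (nr_dist _ y _))// (nrBC _ y).
  rewrite exprS in yuk1.
  by have := half_exp_gt0 (R := R) k; lra.
have Mx : M x.
  move/closed_nrP: cM; apply=> e e0; have [k ke] := half_exp_small (2 * (`|K| * 2)) e0.
  by exists (u k); [have [] := uP k|exact: le_lt_trans (xu k) ke].
exists x => //; apply/esym/subr0_eq/nr_eq0/le_anti.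
rewrite nr_ge0 andbT.
apply: (le0_half_exp (M := 1 + nr S * (2 * (`|K| * 2)))) => k.
rewrite (le_trans (nr_dist _ (S (u k)) _))// mulrDl mul1r lerD//.
  by have [] := uP k.
rewrite -blopB (le_trans (nr_blop _ _))// (nrBC (u k)).
by have := ler_wpM2l (nr_ge0 S) (xu k); rewrite !mulrA.
Qed.

End ClosedRange.

Section Cuts.
Context {R : realType} {V : normedModType R[i]}.
Implicit Types (S : 'L(V)) (E M : set V) (q : blop V R[i]).

(** Built one functional at a time, because consecutive cuts differ by at most
one dimension, which makes inductions on qs work. *)
Definition cut M (qs : seq (blop V R[i])) : set V :=
  foldr (fun q E => E `&` [set x | q x = 0]) M qs.

Lemma lsubspace_cut M qs : lsubspace M -> lsubspace (cut M qs).
Proof.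
by move=> lM; elim: qs => //= q qs IH; apply: lsubspaceI => //; exact: lsubspace_ker.
Qed.
Lemma closed_cut M qs : closed M -> closed (cut M qs).
Proof.
by move=> cM; elim: qs => //= q qs IH; apply: closedI => //; exact: closed_ker.
Qed.

Lemma cutP M qs x : cut M qs x -> M x /\ forall q, q \in qs -> q x = 0.
Proof.
elim: qs => [//|q qs IH] /= [/IH[Mx qsx] qx]; split=> // p.
by rewrite inE => /predU1P[->//|/qsx].
Qed.

Lemma cut_adjoin E q : lsubspace E ->
  E = E `&` [set x | q x = 0] \/
  exists v, E = adjoin (E `&` [set x | q x = 0]) v.
Proof.
move=> lE; have [Eq|/existsNP[v /not_implyP[Ev qv]]] :=
  pselect (E `<=` [set x | q x = 0]); first by left; rewrite setIidl.
right; exists v; apply/seteqP; split=> [y Ey|y [a [Ey _]]]; last first.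
  by rewrite -[y](subrK (a *: v)); apply: lsubspaceD => //; exact: lsubspaceZ.
exists (q y / q v); split.
  by apply: lsubspaceB => //; exact: lsubspaceZ.
rewrite /= blopB blopZ; apply/eqP; rewrite subr_eq0; apply/eqP/esym/divfK.
exact/eqP.
Qed.

(** The image of M is obtained from the image of the cut by adjoining finitely
many vectors, and adjoining a vector preserves closedness. *)
Lemma closed_image_cut S M qs :
  lsubspace M -> closed (S @` cut M qs) -> closed (S @` M).
Proof.
move=> lM; elim: qs => //= q qs IH cS; apply: IH.
have lC := lsubspace_cut qs lM.
have [->//|[v ->]] := cut_adjoin q lC.
rewrite image_adjoin; apply: closed_adjoin => //; apply: lsubspace_image.
by apply: lsubspaceI => //; exact: lsubspace_ker.
Qed.

Lemma finite_span_cut M qs : lsubspace M -> cut M qs `<=` [set 0] ->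
  exists l, M = span_over [set 0] l.
Proof.
move=> lM cut0; have : exists l, cut M qs = span_over [set 0] l.
  by apply: (@sub_finite_span _ _ _ [::]) => //; exact: lsubspace_cut.
elim: qs {cut0} => //= q qs IH [l cE]; apply: IH.
have [->|[v ->]] := cut_adjoin q (lsubspace_cut qs lM); first by exists l.
by exists (v :: l); rewrite /= -cE.
Qed.
End Cuts.

Section SemiFredholm.
Context {R : realType} {V : normedModType R[i]}.
Hypothesis bV : banach V.
Implicit Types S : 'L(V).

(** The right-hand side is visibly stable under small perturbations. From left
to right, q is dual to a basis of the kernel: modulo the kernel S is bounded
below by the open mapping theorem, and on the kernel the q i control the norm.
From right to left, S is bounded below on the common kernel of the q i, a
closed subspace of finite codimension. *)
Lemma upper_semi_fredholmP S : upper_semi_fredholm S <->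
  exists n (q : 'I_n -> blop V R[i]) (K : R), 0 <= K /\
    forall x, nr x <= K * (nr (S x) + \sum_i nr (q i x)).
Proof.
split=> [[[cS _] [n [e [eS eU]]]]|[n [q [K [K0 qK]]]]].
  have [q qe] : exists q : 'I_n -> blop V R[i], forall i j, q i (e j) = (i == j)%:R.
    by apply: dual_family; exact: (basis_independent (blop0 S) eU).
  have l0 := @lsubspace_set0 R V; have lS := lsubspace_range S.
  have [|_ [x _ <-]|K K0 KS] :=
    open_mapping bV bV l0 (@closed_set0 R V) lS cS _ (@subset_refl _ _).
    by move=> _ ->; exact: lS.1.
    by exists x; exact: subrr.
  pose B := \sum_i nr (e i); pose Q := \sum_i nr (q i).
  have B0 : 0 <= B by apply: sumr_ge0 => i _; exact: nr_ge0.
  have Q0 : 0 <= Q by apply: sumr_ge0 => i _; exact: nr_ge0.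
  exists n, q, (K + B * Q * K + B); split; first by rewrite !addr_ge0// !mulr_ge0.
  move=> x; have [|x' /subr0_eq xx' x'K] := KS (S x); first by exists x.
  have kerx : op_ker S (x - x') by rewrite /op_ker/= blopB xx' subrr.
  have xE : x - x' = \sum_i q i (x - x') *: e i.
    have [c [xc _]] := eU _ kerx; rewrite {1}xc; apply: eq_bigr => i _.
    rewrite xc blop_sum (bigD1 i)//= blopZ qe eqxx big1 ?addr0 => [|j ji].
      by congr (_ *: _); rewrite [RHS]mulr1.
    by rewrite blopZ qe eq_sym (negbTE ji); exact: mulr0.
  have qx' : \sum_i nr (q i x') <= Q * (K * nr (S x)).
    rewrite mulr_suml ler_sum// => i _; rewrite (le_trans (nr_blop _ _))//.
    by rewrite ler_wpM2l ?nr_ge0.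
  have xx'B : nr (x - x') <= B * (\sum_i nr (q i x) + \sum_i nr (q i x')).
    rewrite xE (le_trans (nr_sum _ _ _))// -big_split mulr_sumr ler_sum//= => i _.
    rewrite nrZ mulrC ler_pM ?nr_ge0//.
      by rewrite /B (bigD1 i)//= lerDl sumr_ge0// => j _; exact: nr_ge0.
    by rewrite blopB nrB.
  have := nrD (x - x') x'; rewrite subrK.
  have := ler_wpM2l B0 qx'; move: xx'B x'K.
  set s := \sum_i nr (q i x); set s' := \sum_i nr (q i x').
  have s0 : 0 <= s by apply: sumr_ge0 => i _; exact: nr_ge0.
  have := mulr_ge0 (addr_ge0 K0 (mulr_ge0 (mulr_ge0 B0 Q0) K0)) s0.
  have := mulr_ge0 B0 (nr_ge0 (S x)).
  nra.
have q0 x : cut setT [seq q i | i <- enum 'I_n] x -> nr x <= K * nr (S x).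
  move=> /cutP[_ qx]; rewrite (le_trans (qK x))// big1 ?addr0// => i _.
  by rewrite qx ?nr0// map_f// mem_enum.
have lT := @lsubspaceT _ V.
have cS : closed (range S).
  apply: (@closed_image_cut _ _ _ _ [seq q i | i <- enum 'I_n]) => //.
  apply: closed_image_bounded_below q0 => //; first exact: lsubspace_cut.
  by apply: closed_cut; exact: closedT.
have fS : fin_dim (op_ker S).
  have [|l ->] := @finite_span_cut _ _ (op_ker S) [seq q i | i <- enum 'I_n]
      (lsubspace_ker S); last exact: fin_dim_span.
  move=> x /cutP[/= Sx qx]; apply/nr_eq0/le_anti; rewrite nr_ge0 andbT.
  rewrite (le_trans (qK x))// Sx nr0 add0r big1 ?mulr0// => i _.
  by rewrite qx ?nr0// map_f// mem_enum.
by split=> //; split=> //; left.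
Qed.

End SemiFredholm.

(** * Openness of the classes of operators *)

Definition norm_open (R : realType) (V : normedModType R[i]) (P : 'L(V) -> Prop) :=
  forall S, P S -> exists2 e : R, 0 < e & forall S', nr (S - S') < e -> P S'.

Section Openness.
Context {R : realType} {V : normedModType R[i]}.
Hypothesis bV : banach V.
Implicit Types S : 'L(V).

Lemma nr_perturb S S' x : nr (S x - S' x) <= nr (S - S') * nr x.
Proof. exact: (nr_blop (S - S') x). Qed.

Lemma small_perturbation (K : R) : 0 <= K ->
  exists2 e : R, 0 < e & forall S S', nr (S - S') < e -> K * nr (S - S') <= 2^-1.
Proof.
move=> K0; have K1 : 0 < 2 * (K + 1) by rewrite mulr_gt0// ltr_wpDl.
exists (2 * (K + 1))^-1 => [|S S' SS']; first by rewrite invr_gt0.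
rewrite (le_trans (ler_wpM2l K0 (ltW SS')))// ler_pdivrMr//.
by rewrite mulrA mulVf ?mul1r// lerDl.
Qed.

Lemma norm_open_upper : norm_open (@upper_semi_fredholm R V).
Proof.
move=> S /(upper_semi_fredholmP bV)[n [q [K [K0 qK]]]].
have [e e0 eP] := small_perturbation K0; exists e => // S' SS'.
apply/(upper_semi_fredholmP bV); exists n, q, (2 * K); split.
  by rewrite mulr_ge0.
move=> x; have := qK x; have := ler_wpM2r (nr_ge0 x) (eP S S' SS').
have := ler_wpM2l K0 (nr_perturb S S' x); rewrite mulrA.
have : K * nr (S x) <= K * (nr (S x - S' x) + nr (S' x)).
  by rewrite ler_wpM2l// -{1}(subrK (S' x) (S x)) nrD.
lra.
Qed.

(** Left to right is the open mapping theorem modulo the span of vectors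
completing the range. From right to left, closedness of the range has to be
recovered: if y is a limit of points z of the range, the errors f of the
solutions for y - z tend to 0 while staying in one coset of the intersection
of the range with the span of l, which is closed because it is finite
dimensional. *)
Lemma lower_semi_fredholmP S : lower_semi_fredholm S <->
  exists l (K : R), 0 <= K /\
    forall y, exists2 x, span_over [set 0] l (y - S x) & nr x <= K * nr y.
Proof.
have l0 := @lsubspace_set0 R V; have lS := lsubspace_range S.
split=> [[_ [n [e eU]]]|[l [K [K0 lK]]]].
  pose l := [seq e i | i <- enum 'I_n]; exists l.
  have spanl : forall x, exists2 z, span_over [set 0] l z & range S (x - z).
    apply: quotient_basis_span => // x.
    by have [c [Sc _]] := eU x; exists c.
  have lT := @lsubspaceT R V.
  have [//|y _|K K0 KP] := open_mapping bV bV (lsubspace_span l l0)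
      (@closed_span _ _ _ l l0 (@closed_set0 R V)) lT closedT (@subsetT _ _)
      (S := S).
    have [z lz [x _ xz]] := spanl y.
    by exists x; rewrite xz opprB addrC subrK.
  by exists K; split=> // y; exact: KP.
have lF := lsubspace_span l l0.
suff cS : closed (range S).
  have codimS : fin_codim (range S).
    apply: (@fin_codim_span _ _ _ l) => //; apply/seteqP; split=> // y _.
    have lSl := lsubspace_span l lS; have [x lx _] := lK y.
    rewrite -[y](subrK (S x)); apply: lsubspaceD => //; last first.
      have Sx : range S (S x) by exists x.
      exact: subset_span_over Sx.
    suff : span_over [set 0] l `<=` span_over (range S) l by apply.
    elim: {lK lF lSl lx} l => [|v l IH] /=; first by move=> _ ->; exact: lS.1.
    by move=> z [a /IH la]; exists a.
  by split=> //; split=> //; right.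
have cF0 : closed (range S `&` span_over [set 0] l).
  apply: (@closed_sub_finite_span _ _ _ l); first exact: lsubspaceI.
  exact: subIsetr.
apply/closed_nrP => y yS.
have [z1 Sz1 _] := yS 1 ltr01; have [x1 lx1 _] := lK (y - z1).
set f1 := y - z1 - S x1 in lx1.
suff [Sf1 _] : (range S `&` span_over [set 0] l) f1.
  have -> : y = z1 + (S x1 + f1) by rewrite /f1 [S x1 + _]addrC subrK addrC subrK.
  apply: lsubspaceD => //; apply: lsubspaceD => //; by exists x1.
move/closed_nrP: cF0; apply=> e e0.
have M0 : 0 < 1 + nr S * K by rewrite ltr_pwDl// mulr_ge0 ?nr_ge0.
have [z Sz yz] := yS _ (divr_gt0 e0 M0); have [x lx xK] := lK (y - z).
set f := y - z - S x in lx.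
exists (f1 - f); last first.
  rewrite opprB addrC subrK (le_lt_trans (nrB _ _))//.
  apply: (@le_lt_trans _ _ (nr (y - z) * (1 + nr S * K))).
    rewrite mulrDr mulr1 lerD2l (le_trans (nr_blop _ _))//.
    by rewrite [leRHS]mulrC -mulrA ler_wpM2l ?nr_ge0.
  by rewrite -ltr_pdivlMr.
split; last exact: lsubspaceB.
have -> : f1 - f = (z - z1) + (S x - S x1).
  rewrite /f1 /f -(addrA y (- z1)) -(addrA y (- z)) -!opprD [- (y - _)]opprB.
  by rewrite [LHS]addrC subrKA opprD addrACA.
apply: lsubspaceD => //; first exact: lsubspaceB.
by rewrite -blopB; exists (x - x1).
Qed.

Lemma norm_open_lower : norm_open (@lower_semi_fredholm R V).
Proof.
move=> S /lower_semi_fredholmP[l [K [K0 lK]]].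
have [e e0 eP] := small_perturbation K0; exists e => // S' SS'.
apply/lower_semi_fredholmP; exists l, (2 * K); split; first by rewrite mulr_ge0.
have l0 := @lsubspace_set0 R V.
move=> y; apply: (iterated_solution (L := setT)) => //.
  exact: lsubspace_span.
  by apply: closed_span => //; exact: closed_set0.
move=> {}y _; have [x lx xK] := lK y; exists x, (S x - S' x); split=> //.
  move: lx; congr (span_over _ _).
  by rewrite opprB -[RHS]addrA [S' x - _ - _]addrAC subrr add0r.
rewrite (le_trans (nr_perturb S S' x))//.
rewrite (le_trans (ler_wpM2l (nr_ge0 _) xK))// mulrA mulrC ler_wpM2l ?nr_ge0//.
by rewrite mulrC eP.
Qed.

Lemma semi_fredholmE S :
  semi_fredholm S <-> upper_semi_fredholm S \/ lower_semi_fredholm S.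
Proof.
split=> [[cS [fS|fS]]|[[]|[]]//]; first by left; split=> //; split=> //; left.
by right; split=> //; split=> //; right.
Qed.

Lemma norm_openU (P Q : 'L(V) -> Prop) :
  norm_open P -> norm_open Q -> norm_open (fun S => P S \/ Q S).
Proof.
move=> oP oQ S [/oP|/oQ] [e e0 H]; exists e => // S' /H; by [left|right].
Qed.

Lemma norm_openI (P Q : 'L(V) -> Prop) :
  norm_open P -> norm_open Q -> norm_open (fun S => P S /\ Q S).
Proof.
move=> oP oQ S [/oP[e e0 eP] /oQ[d d0 dQ]].
exists (Num.min e d); first by rewrite lt_min e0.
by move=> S'; rewrite lt_min => /andP[/eP ? /dQ].
Qed.

Lemma norm_open_semi_fredholm : norm_open (@semi_fredholm R V).
Proof.
move=> S /semi_fredholmE /(norm_openU norm_open_upper norm_open_lower)[e e0 H].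
by exists e => // S' /H/semi_fredholmE.
Qed.

Lemma norm_open_fredholm : norm_open (@fredholm R V).
Proof. exact: norm_openI norm_open_upper norm_open_lower. Qed.

Lemma invertibleP S : invertible S <->
  (forall y, exists x, S x = y) /\ exists K : R, forall x, nr x <= K * nr (S x).
Proof.
split=> [[Q [SQ QS]]|[Ssurj [K SK]]].
  have SQx x : S (Q x) = x by rewrite -[RHS](congr1 (fun f : 'L(V) => f x) SQ).
  have QSx x : Q (S x) = x by rewrite -[RHS](congr1 (fun f : 'L(V) => f x) QS).
  split=> [y|]; first by exists (Q y).
  by exists (nr Q) => x; rewrite -{1}(QSx x) nr_blop.
have /choice[Q SQ] := Ssurj.
have Sinj x y : S x = S y -> x = y.
  move=> Sxy; apply/subr0_eq/nr_eq0/le_anti; rewrite nr_ge0 andbT.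
  by rewrite (le_trans (SK _))// blopB Sxy subrr nr0 mulr0.
have Qlin : linear Q.
  by move=> a x y; apply: Sinj; rewrite blopD blopZ !SQ.
have QK x : nr (Q x) <= K * nr x by rewrite (le_trans (SK _))// SQ.
exists (BLop (bounded_linear_nr Qlin QK)); split; apply: blop_ext => x.
  exact: SQ.
by apply: Sinj; exact: SQ.
Qed.

(** The bounded inverse theorem. *)
Lemma bijective_invertible S :
  (forall y, exists x, S x = y) -> (forall x, S x = 0 -> x = 0) -> invertible S.
Proof.
move=> Ssurj Sinj; apply/invertibleP; split=> //.
have l0 := @lsubspace_set0 R V; have lT := @lsubspaceT R V.
have [//|y _|K K0 KS] := open_mapping bV bV l0 (@closed_set0 R V) lT closedT
    (@subsetT _ _) (S := S).
  by have [x <-] := Ssurj y; exists x; exact: subrr.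
exists K => x; have [//|x' /= xx' x'K] := KS (S x).
have /Sinj/subr0_eq xE : S (x - x') = 0 by rewrite blopB.
by rewrite {1}xE.
Qed.

(** Surjectivity survives by successive approximation, the lower bound by the
triangle inequality. *)
Lemma norm_open_invertible : norm_open (@invertible R V).
Proof.
move=> S /invertibleP[Ssurj [K SK]].
have [e e0 eP] := small_perturbation (normr_ge0 K); exists e => // S' SS'.
have SK' x : nr x <= `|K| * nr (S x).
  by rewrite (le_trans (SK x))// ler_wpM2r ?nr_ge0// ler_norm.
have l0 := @lsubspace_set0 R V.
apply/invertibleP; split=> [y|].
  have H := iterated_solution (S := S') (L := setT)
      bV l0 (@closed_set0 R V) (normr_ge0 K).
  have [z _||x /= /subr0_eq xy _] := H _ y; [|by []|by exists x].
  have [x xz] := Ssurj z; exists x, (S x - S' x); split=> //.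
  - by rewrite -xz opprB addrCA subrr addr0 subrr.
  - by rewrite -xz SK'.
  rewrite (le_trans (nr_perturb S S' x))//.
  rewrite (le_trans (ler_wpM2l (nr_ge0 _) (SK' x)))// xz mulrA mulrC.
  by rewrite ler_wpM2l ?nr_ge0// mulrC eP.
exists (2 * `|K|) => x; have := SK' x.
have := ler_wpM2r (nr_ge0 x) (eP S S' SS').
have := ler_wpM2l (normr_ge0 K) (nr_perturb S S' x); rewrite mulrA.
have : `|K| * nr (S x) <= `|K| * (nr (S x - S' x) + nr (S' x)).
  by rewrite ler_wpM2l// -{1}(subrK (S' x) (S x)) nrD.
lra.
Qed.

End Openness.

(** * Index zero and finite-rank perturbations *)

(** The rows of [row_base D^C] form a basis of the row space of a complement
of D. *)
Lemma compl_decomposition (F : fieldType) n (D : 'M[F]_n) (v : 'rV[F]_n) :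
  exists! d : 'rV[F]_(\rank (D^C)%MS), (v - d *m row_base (D^C)%MS <= D)%MS.
Proof.
have : (v <= D + D^C)%MS by rewrite submx_full// addsmx_compl_full.
move=> /sub_addsmxP[[u1 u2] /= vE].
have /submxP[d dE] : (u2 *m D^C <= row_base (D^C)%MS)%MS.
  by rewrite eq_row_base submxMl.
exists d; split=> [|d' d'D].
  by rewrite vE -dE addrK submxMl.
have dD : (v - d *m row_base (D^C)%MS <= D)%MS by rewrite vE -dE addrK submxMl.
apply: (row_free_inj (row_base_free (D^C)%MS)); apply/eqP.
rewrite -subr_eq0 -submx0 -(capmx_compl D) sub_capmx; apply/andP; split.
  rewrite [X in (X <= _)%MS](_ : _ = (v - d' *m row_base (D^C)%MS) -
      (v - d *m row_base (D^C)%MS)); first by rewrite addmx_sub// eqmx_opp.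
  by rewrite [RHS]addrC opprB subrKA.
by rewrite -mulmxBl (submx_trans (submxMl _ _))// eq_row_base.
Qed.

Section FiniteRank.
Context {R : realType} {V : normedModType R[i]}.
Implicit Types S : 'L(V).

Definition finite_rank_fun n (q : 'I_n -> blop V R[i]) (f : 'I_n -> V) (x : V) : V :=
  \sum_i q i x *: f i.

Lemma finite_rank_linear n (q : 'I_n -> blop V R[i]) f :
  linear (finite_rank_fun q f).
Proof.
move=> a x y; rewrite /finite_rank_fun scaler_sumr -big_split.
by apply: eq_bigr => i _; rewrite blopD blopZ scalerDl scalerA.
Qed.

Lemma finite_rank_bounded n (q : 'I_n -> blop V R[i]) f x :
  nr (finite_rank_fun q f x) <= (\sum_i nr (q i) * nr (f i)) * nr x.
Proof.
rewrite (le_trans (nr_sum _ _ _))// mulr_suml ler_sum// => i _.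
by rewrite nrZ mulrAC ler_wpM2r ?nr_ge0// nr_blop.
Qed.

Definition finite_rank n (q : 'I_n -> blop V R[i]) (f : 'I_n -> V) : 'L(V) :=
  BLop (bounded_linear_nr (finite_rank_linear q f) (finite_rank_bounded q f)).

Lemma finite_rankE n (q : 'I_n -> blop V R[i]) f x :
  finite_rank q f x = \sum_i q i x *: f i.
Proof. by []. Qed.

(** As kernel and cokernel have the same dimension, a finite-rank operator can
map a basis of the first onto a basis of a complement of the range. *)
Lemma weyl_invertible_perturbation S : banach V -> weyl S ->
  exists n (q : 'I_n -> blop V R[i]) f, invertible (S + finite_rank q f).
Proof.
move=> bV [_ [n [m [[e [eS eU]] [f fU] /esym/eqP]]]].
rewrite subr_eq0 => /eqP[nm]; subst m.
have lS := lsubspace_range S.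
have [q qe] : exists q : 'I_n -> blop V R[i], forall i j, q i (e j) = (i == j)%:R.
  by apply: dual_family; exact: (basis_independent (blop0 S) eU).
have q_comb (c : 'I_n -> R[i]) j : q j (\sum_i c i *: e i) = c j.
  rewrite blop_sum (bigD1 j)//= blopZ qe eqxx big1 ?addr0 => [|i ij].
    exact: mulr1.
  by rewrite blopZ qe eq_sym (negbTE ij); exact: mulr0.
exists n, q, f; apply: bijective_invertible => // [y|x].
  have [c [[x _ xy] _]] := fU y.
  (* changing x by an element of the kernel adjusts its coordinates q i x to c *)
  exists (x + \sum_i (c 0 i - q i x) *: e i).
  rewrite blop_addE blopD blop_sum big1 => [|i _]; last first.
    by rewrite blopZ (eS i) scaler0.
  rewrite addr0 xy finite_rankE.
  under [X in _ - _ + X]eq_bigr do rewrite blopD q_comb subrKC.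
  by rewrite subrK.
rewrite blop_addE finite_rankE => Gx.
have qx0 : forall i, q i x = 0.
  apply: (quotient_basis_independent lS fU); exists (- x) => //.
  by apply/esym/eqP; rewrite -subr_eq0 -[- x]sub0r blopB blop0 sub0r opprK addrC Gx.
have [c [xc _]] : exists! c : 'rV_n, x = \sum_(i < n) c 0 i *: e i.
  by apply: eU; move: Gx; rewrite big1 ?addr0// => i _; rewrite qx0 scale0r.
rewrite xc big1// => i _.
by have := qx0 i; rewrite {1}xc q_comb => ->; rewrite scale0r.
Qed.

(** Write G = S + F with F of finite rank and Q the inverse of G. Then Q S = 1
- B q', where q' collects the n functionals of F and B sends a row c to the
combination of the vectors Q (f i) with coefficients c. The kernel and
cokernel of 1 - B q' are those of the n x n matrix D of 1 - q' B, through B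
and q', and for a square matrix they have the same dimension. *)
Lemma has_index0_of_invertible_perturbation S n (q : 'I_n -> blop V R[i]) f :
  invertible (S + finite_rank q f) -> has_index S 0.
Proof.
move=> [Q [GQ QG]]; set G := S + _ in GQ QG.
have GQx x : G (Q x) = x by rewrite -[RHS](congr1 (fun f : 'L(V) => f x) GQ).
have QGx x : Q (G x) = x by rewrite -[RHS](congr1 (fun f : 'L(V) => f x) QG).
pose b i := Q (f i).
pose B (c : 'rV[R[i]]_n) : V := \sum_i c 0 i *: b i.
pose q' (x : V) : 'rV[R[i]]_n := \row_i q i x.
(* rows act on the left: c *m D stands for c - q' (B c) *)
pose D : 'M[R[i]]_n := 1%:M - \matrix_(i, j) q j (b i).
have BD c d : B (c + d) = B c + B d.
  by rewrite /B -big_split; apply: eq_bigr => i _; rewrite mxE scalerDl.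
have BZ a c : B (a *: c) = a *: B c.
  by rewrite /B scaler_sumr; apply: eq_bigr => i _; rewrite mxE scalerA.
have BB c d : B (c - d) = B c - B d by rewrite BD -[- d]scaleN1r BZ scaleN1r.
have B0 : B 0 = 0 by rewrite -[0](subrr 0) BB subrr.
have Bmul m (c : 'rV[R[i]]_m) (A : 'M[R[i]]_(m, n)) :
    B (c *m A) = \sum_k c 0 k *: B (row k A).
  by rewrite mulmx_sum_row (big_morph B BD B0); apply: eq_bigr => k _; rewrite BZ.
have q'B x y : q' (x - y) = q' x - q' y.
  by apply/rowP => i; rewrite !mxE blopB.
have q'D x y : q' (x + y) = q' x + q' y.
  by apply/rowP => i; rewrite !mxE blopD.
have q'Bc c : q' (B c) = c - c *m D.
  rewrite mulmxBr mulmx1 opprB addrCA subrr addr0; apply/rowP => j.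
  by rewrite !mxE blop_sum; apply: eq_bigr => i _; rewrite blopZ mxE.
have QS x : Q (S x) = x - B (q' x).
  have -> : S x = G x - \sum_i q i x *: f i by rewrite /G blop_addE finite_rankE addrK.
  rewrite blopB QGx blop_sum; congr (_ - _); apply: eq_bigr => i _.
  by rewrite blopZ mxE.
have kerP x : op_ker S x <-> x = B (q' x).
  split=> [Sx|xB]; first by apply/subr0_eq; rewrite -QS Sx blop0.
  by rewrite /op_ker/= -[S x]GQx QS -xB subrr blop0.
have rangeP y : range S y <-> (q' (Q y) <= D)%MS.
  split=> [[x _ <-]|/submxP[c cD]].
    by rewrite QS q'B q'Bc opprB addrCA subrr addr0 submxMl.
  exists (Q y + B c) => //; rewrite -[LHS]GQx QS.
  have -> : q' (Q y + B c) = c.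
    by rewrite q'D cD q'Bc addrC subrK.
  by rewrite addrK GQx.
exists (\rank (kermx D)), (\rank (D^C)%MS); split.
- pose K := row_base (kermx D).
  have KD0 (d : 'rV_(\rank (kermx D))) : d *m K *m D = 0.
    by apply/sub_kermxP; rewrite (submx_trans (submxMl _ _))// eq_row_base.
  exists (fun k => B (row k K)); split=> [k|x /kerP xB].
    apply/kerP; rewrite q'Bc.
    by have := KD0 (delta_mx 0 k); rewrite -rowE => ->; rewrite subr0.
  have /submxP[d dK] : (q' x <= K)%MS.
    rewrite eq_row_base; apply/sub_kermxP.
    have := congr1 q' xB; rewrite q'Bc => /esym/eqP.
    by rewrite subr_eq addrC -subr_eq subrr eq_sym => /eqP.
  exists d; split=> [|d' xd']; first by rewrite -Bmul -dK.
  apply: (row_free_inj (row_base_free (kermx D))).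
  have := congr1 q' xd'; by rewrite -Bmul q'Bc KD0 subr0 dK.
- pose K := row_base (D^C)%MS.
  have q'K y (d : 'rV_(\rank (D^C)%MS)) :
      range S (y - \sum_k d 0 k *: G (B (row k K))) <-> (q' (Q y) - d *m K <= D)%MS.
    have -> : \sum_k d 0 k *: G (B (row k K)) = G (B (d *m K)).
      by rewrite Bmul blop_sum; apply: eq_bigr => k _; rewrite blopZ.
    rewrite rangeP blopB QGx q'B q'Bc opprB addrA addrAC; split=> H.
      by rewrite -[X in (X <= _)%MS](addrK (d *m K *m D)) addmx_sub// eqmx_opp submxMl.
    by rewrite addmx_sub// submxMl.
  exists (fun k => G (B (row k K))) => y.
  have [d [dD dU]] := compl_decomposition D (q' (Q y)).
  exists d; split; first exact/q'K.
  by move=> d' /q'K/dU.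
- by rewrite mxrank_ker mxrank_compl subrr.
Qed.

(** Near a Weyl operator S the same finite-rank perturbation still gives an
invertible operator, so the index remains zero. *)
Lemma norm_open_weyl : banach V -> norm_open (@weyl R V).
Proof.
move=> bV S wS; have [e e0 eP] := norm_open_fredholm bV wS.1.
have [n [q [f inv]]] := weyl_invertible_perturbation bV wS.
have [d d0 dP] := norm_open_invertible bV inv.
exists (Num.min e d) => [|S']; first by rewrite lt_min e0.
rewrite lt_min => /andP[Se Sd]; split; first exact: eP.
apply: (@has_index0_of_invertible_perturbation _ n q f); apply: dP.
by rewrite opprD addrACA subrr addr0.
Qed.
End FiniteRank.

(** * Infinite subgroups of the circle *)

Section Circle.
Context {R : realType}.
Implicit Types (s t : R) (z : R[i]).

(** The exponential exp(i t). *)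
Definition cexp (t : R) : R[i] := cos t +i* sin t.

Lemma cexpD s t : cexp (s + t) = cexp s * cexp t.
Proof.
by apply/eqP; rewrite eq_complex /= cosD sinD [sin s * cos t + _]addrC !eqxx.
Qed.

Lemma cexp0 : cexp 0 = 1.
Proof. by rewrite /cexp cos0 sin0. Qed.

Lemma unit_circleE z : unit_circle z <-> nr z = 1.
Proof.
rewrite /unit_circle /= -nr_norm; split=> [|->//].
by move=> /(congr1 (@complex.Re R)).
Qed.

Lemma nr_cexp t : nr (cexp t) = 1.
Proof. by rewrite /nr normc_def /= cos2Dsin2 sqrtr1. Qed.

Lemma cexp_neq0 t : cexp t != 0.
Proof.
by apply/eqP => t0; have := nr_cexp t; rewrite t0 nr0 => /esym/eqP; rewrite oner_eq0.
Qed.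

Lemma unit_circle_cexp z : unit_circle z ->
  exists t, - pi <= t <= pi /\ z = cexp t.
Proof.
case: z => a b /unit_circleE; rewrite /nr normc_def /= => ab.
have {}ab : a ^+ 2 + b ^+ 2 = 1.
  by rewrite -[LHS]sqr_sqrtr ?ab ?expr1n// addr_ge0// sqr_ge0.
have a1 : -1 <= a <= 1.
  rewrite -ler_norml -(@ler_pXn2r _ 2) ?nnegrE// expr1n real_normK ?num_real//.
  by rewrite -ab lerDl sqr_ge0.
have bE : sin (acos a) = `|b| by rewrite sin_acos// -ab addrAC subrr add0r sqrtr_sqr.
have := acos_ge0 a1; have := acos_lepi a1; have := pi_ge0 R => pi0 api a0.
have [b0|b0] := leP 0 b.
  exists (acos a); split; first by apply/andP; split; lra.
  by rewrite /cexp acosK ?in_itv// bE ger0_norm.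
exists (- acos a); split; first by apply/andP; split; lra.
by rewrite /cexp cosN sinN acosK ?in_itv// bE ltr0_norm// opprK.
Qed.

Lemma cexp_continuous0 (e : R) : 0 < e ->
  exists2 d : R, 0 < d & forall t, `|t| < d -> nr (cexp t - 1) < e.
Proof.
move=> e0; have e2 : 0 < e / 2 by rewrite divr_gt0.
have /cvgrPdist_lt/(_ _ e2) := @continuous_cos R 0.
have /cvgrPdist_lt/(_ _ e2) := @continuous_sin R 0.
move=> /nbhs_ballP[d1 /= d10 sinP] /nbhs_ballP[d2 /= d20 cosP].
exists (Num.min d1 d2); first by rewrite lt_min d10.
move=> t; rewrite lt_min => /andP[td1 td2].
have := sinP t; rewrite /ball /= sub0r normrN => /(_ td1).
have := cosP t; rewrite /ball /= sub0r normrN => /(_ td2).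
rewrite cos0 sin0 sub0r normrN distrC => ct st.
apply: (le_lt_trans (nr_ReIm _)); rewrite !raddfB /= subr0.
by rewrite [e]splitr ltrD.
Qed.

(** Pigeonhole: distribute the arguments of the elements of G, all in [- pi,
pi], into finitely many bins of width d. Two distinct elements share a bin,
and their quotient is exp(i h) with 0 < |h| < d. *)
Lemma infinite_circle_subgroup_small (G : set R[i]) (d : R) :
    circle_subgroup G -> infinite_set G -> 0 < d ->
  exists h, [/\ 0 < h, h < d & G (cexp h)].
Proof.
move=> [Gcircle G1 GV] Ginf d0; apply: contrapT => noh.
have GB s t : G (cexp s) -> G (cexp t) -> G (cexp (s - t)).
  move=> Gs Gt; have := GV _ _ Gs Gt; congr G.
  by apply: (mulIf (cexp_neq0 t)); rewrite divfK ?cexp_neq0// -cexpD subrK.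
have /choice[theta thetaP] : forall z, exists t, G z ->
    - pi <= t <= pi /\ z = cexp t.
  move=> z; have [Gz|nGz] := pselect (G z); last by exists 0.
  by have [t tP] := unit_circle_cexp (Gcircle z Gz); exists t.
(* the shift by pi makes the truncated quotient nonnegative *)
pose bin z := Num.truncn ((theta z + pi) / d).
have bin_inj x y : G x -> G y -> bin x = bin y -> x = y.
  move=> Gx Gy; have [/andP[px _] xE] := thetaP _ Gx.
  have [/andP[py _] yE] := thetaP _ Gy => bxy.
  have x0 : 0 <= (theta x + pi) / d by apply: divr_ge0; [lra|exact: ltW].
  have y0 : 0 <= (theta y + pi) / d by apply: divr_ge0; [lra|exact: ltW].
  have /andP[+ +] := truncn_itv x0; have /andP[+ +] := truncn_itv y0.
  rewrite -/(bin x) -/(bin y) -bxy ler_pdivlMr// ltr_pdivrMr// -natr1 mulrDl mul1r.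
  rewrite ler_pdivlMr// ltr_pdivrMr// mulrDl mul1r => y1 y2 x1 x2.
  have [xy|xy|xy] := ltgtP (theta x) (theta y); last by rewrite xE yE xy.
    exfalso; apply: noh; exists (theta y - theta x); split; [lra|lra|].
    by apply: GB; rewrite -?xE -?yE.
  exfalso; apply: noh; exists (theta x - theta y); split; [lra|lra|].
  by apply: GB; rewrite -?xE -?yE.
apply: Ginf; pose N := (Num.truncn (2 * pi / d : R)).+1.
pose pick k := xget 0 [set z | G z /\ bin z = k].
apply: (@sub_finite_set _ _ (pick @` `I_N)); last exact/finite_image/finite_II.
move=> z Gz; exists (bin z).
  have [/andP[_ zp] _] := thetaP _ Gz.
  rewrite /= /N ltnS; apply: le_truncn; rewrite ler_pM2r ?invr_gt0//; lra.
have [Gp binp] : [set z' | G z' /\ bin z' = bin z] (pick (bin z)).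
  by apply: xgetPex; exists z.
exact: bin_inj.
Qed.

(** The integer powers of exp(i h) with h small come within h of every
argument. *)
Lemma infinite_circle_subgroup_dense (G : set R[i]) (z : R[i]) (e : R) :
    circle_subgroup G -> infinite_set G -> unit_circle z -> 0 < e ->
  exists2 g, G g & nr (g - z) < e.
Proof.
move=> GC Ginf /unit_circle_cexp[s [_ ->]] /cexp_continuous0[d d0 dP].
have [h [h0 hd Gh]] := infinite_circle_subgroup_small GC Ginf d0.
have [_ G1 GV] := GC.
have GVh x : G x -> G x^-1 by move=> Gx; rewrite -div1r; exact: GV.
have GM x y : G x -> G y -> G (x * y).
  by move=> Gx Gy; rewrite -[y]invrK; apply: GV => //; exact: GVh.
have Gnat (n : nat) : G (cexp (n%:R * h)).
  elim: n => [|n IH]; first by rewrite mul0r cexp0.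
  by rewrite -natr1 mulrDl mul1r cexpD; exact: GM.
have Gint (n : int) : G (cexp (n%:~R * h)).
  case: n => n; first exact: Gnat.
  have -> : cexp ((Negz n)%:~R * h) = (cexp (n.+1%:R * h))^-1.
    apply: (mulIf (cexp_neq0 (n.+1%:R * h))); rewrite mulVf ?cexp_neq0//.
    by rewrite -cexpD NegzE mulrNz mulNr addNr cexp0.
  exact/GVh/Gnat.
pose n := Num.floor (s / h); exists (cexp (n%:~R * h)) => //.
have -> : cexp (n%:~R * h) - cexp s = cexp s * (cexp (n%:~R * h - s) - 1).
  by rewrite mulrBr mulr1 -cexpD subrKC.
rewrite nrM nr_cexp mul1r; apply: dP; apply: le_lt_trans hd.
have /andP[] := floor_itv (s / h); rewrite -/n ler_pdivlMr// ltr_pdivrMr//.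
rewrite intrD mulrDl mul1r ler_norml => ? ?; apply/andP; split; lra.
Qed.

End Circle.

(** * Rotating the spectrum by similarity *)

Section Equivalence.
Context {R : realType} {V : normedModType R[i]}.
Hypothesis bV : banach V.
Implicit Types (S A B D : 'L(V)).

Lemma inverse_ofK A Q : inverse_of A Q ->
  (forall x, A (Q x) = x) /\ (forall x, Q (A x) = x).
Proof.
move=> [AQ QA]; split=> x.
  by rewrite -[RHS](congr1 (fun f : 'L(V) => f x) AQ).
by rewrite -[RHS](congr1 (fun f : 'L(V) => f x) QA).
Qed.

(** Rotating the spectral parameter changes the pencil by a similarity and a
scalar; independent invertible factors on the two sides absorb the scalar. *)
Definition equivalent S1 S2 : Prop :=
  exists B D, [/\ invertible B, invertible D & S1 = B * S2 * D].

Definition equivalence_invariant (P : 'L(V) -> Prop) : Prop :=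
  forall S1 S2, equivalent S1 S2 -> P S2 -> P S1.

Lemma has_dim_ker_equivalent S1 S2 n :
  equivalent S1 S2 -> has_dim (op_ker S2) n -> has_dim (op_ker S1) n.
Proof.
move=> [B [D [[B' /inverse_ofK[BB' B'B]] [D' /inverse_ofK[DD' D'D]] ->]]] [e [eS eU]].
have kerE x : op_ker (B * S2 * D) x <-> op_ker S2 (D x).
  rewrite /op_ker /=; split=> [Bx|->]; last exact: blop0.
  by rewrite -[LHS]B'B Bx blop0.
exists (fun i => D' (e i)); split=> [i|x /kerE/eU[c [xc cU]]].
  by apply/kerE; rewrite DD'.
have sumE (d : 'rV_n) : x = \sum_(i < n) d 0 i *: D' (e i) <->
    D x = \sum_(i < n) d 0 i *: e i.
  split=> [->|Dx].
    by rewrite blop_sum; apply: eq_bigr => i _; rewrite blopZ DD'.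
  by rewrite -[LHS]D'D Dx blop_sum; apply: eq_bigr => i _; rewrite blopZ.
by exists c; split=> [|d /sumE/cU//]; exact/sumE.
Qed.

Lemma range_equivalent S B D : invertible D -> range (B * S * D) = B @` range S.
Proof.
move=> [D' /inverse_ofK[DD' _]]; apply/seteqP; split=> [_ [x _ <-]|_ [_ [x _ <-] <-]].
  by exists (S (D x)) => //; exists (D x).
by exists (D' x) => //=; rewrite DD'.
Qed.

Lemma has_codim_range_equivalent S1 S2 n :
  equivalent S1 S2 -> has_codim (range S2) n -> has_codim (range S1) n.
Proof.
move=> [B [D [[B' /inverse_ofK[BB' B'B]] Dinv ->]]] [e eU].
rewrite range_equivalent//; exists (fun i => B (e i)) => y.
have [c [cS cU]] := eU (B' y).
have imE (d : 'rV_n) : (B @` range S2) (y - \sum_(i < n) d 0 i *: B (e i)) <->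
    range S2 (B' y - \sum_(i < n) d 0 i *: e i).
  have -> : y - \sum_(i < n) d 0 i *: B (e i) =
      B (B' y - \sum_(i < n) d 0 i *: e i).
    by rewrite blopB BB' blop_sum; congr (_ - _); apply: eq_bigr => i _; rewrite blopZ.
  split=> [[z Sz] zB|Sz]; last by exists (B' y - \sum_(i < n) d 0 i *: e i).
  by rewrite -[X in range S2 X]B'B -zB B'B.
by exists c; split=> [|d /imE/cU//]; exact/imE.
Qed.

Lemma closed_range_equivalent S1 S2 :
  equivalent S1 S2 -> closed (range S2) -> closed (range S1).
Proof.
move=> [B [D [/invertibleP[_ [K BK]] Dinv ->]]] cS; rewrite range_equivalent//.
by apply: closed_image_bounded_below bV (lsubspace_range _) cS _ => x _.
Qed.

Lemma upper_semi_fredholm_invariant : equivalence_invariant (@upper_semi_fredholm R V).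
Proof.
move=> S1 S2 S12 [[cS _] [n nS]].
have fS : fin_dim (op_ker S1) by exists n; exact: has_dim_ker_equivalent nS.
by split=> //; split; [exact: closed_range_equivalent cS|left].
Qed.

Lemma lower_semi_fredholm_invariant : equivalence_invariant (@lower_semi_fredholm R V).
Proof.
move=> S1 S2 S12 [[cS _] [n nS]].
have fS : fin_codim (range S1) by exists n; exact: has_codim_range_equivalent nS.
by split=> //; split; [exact: closed_range_equivalent cS|right].
Qed.

Lemma semi_fredholm_invariant : equivalence_invariant (@semi_fredholm R V).
Proof.
move=> S1 S2 S12 /semi_fredholmE[uS|lS]; apply/semi_fredholmE.
  by left; exact: upper_semi_fredholm_invariant uS.
by right; exact: lower_semi_fredholm_invariant lS.
Qed.

Lemma fredholm_invariant : equivalence_invariant (@fredholm R V).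
Proof.
move=> S1 S2 S12 [uS lS].
split; first exact: upper_semi_fredholm_invariant uS.
exact: lower_semi_fredholm_invariant lS.
Qed.

Lemma weyl_invariant : equivalence_invariant (@weyl R V).
Proof.
move=> S1 S2 S12 [fS [n [m [nS mS nm]]]]; split.
  exact: fredholm_invariant fS.
exists n, m; split=> //; first exact: has_dim_ker_equivalent nS.
exact: has_codim_range_equivalent mS.
Qed.

Lemma invertibleM A B : invertible A -> invertible B -> invertible (A * B).
Proof.
move=> [A' [AA' A'A]] [B' [BB' B'B]]; exists (B' * A'); split.
  by rewrite mulrA -(mulrA A) BB' mulr1.
by rewrite mulrA -(mulrA B') A'A mulr1.
Qed.

Lemma invertible_invariant : equivalence_invariant (@invertible R V).
Proof.
by move=> S1 S2 [B [D [iB iD ->]]] iS; apply: invertibleM => //; exact: invertibleM.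
Qed.
End Equivalence.

Section RotationInvariance.
Context {R : realType}.
Implicit Types (E : set R[i]) (z g : R[i]).

Lemma unit_circle_neq0 z : unit_circle z -> z != 0.
Proof. by rewrite /unit_circle /= => z1; rewrite -normr_eq0 z1 oner_eq0. Qed.

Lemma unit_circleV z : unit_circle z -> unit_circle z^-1.
Proof. by rewrite /unit_circle /= normfV => ->; rewrite invr1. Qed.

Lemma rotation_invariantI E :
  (forall z x, unit_circle z -> E x -> E (z * x)) -> rotation_invariant E.
Proof.
move=> Ez z z1; apply/seteqP; split=> [_ [x Ex <-]|x Ex]; first exact: Ez.
exists (z^-1 * x); first by apply: Ez => //; exact: unit_circleV.
by rewrite mulVKf ?unit_circle_neq0.
Qed.

Lemma rotation_invariantE E z x :
  rotation_invariant E -> unit_circle z -> E x -> E (z * x).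
Proof. by move=> Einv z1 Ex; rewrite -(Einv z z1); exists x. Qed.

Lemma rotation_invariantC E : rotation_invariant E -> rotation_invariant (~` E).
Proof.
move=> Einv; apply: rotation_invariantI => z x z1 nEx Ezx; apply: nEx.
have := rotation_invariantE Einv (unit_circleV z1) Ezx.
by rewrite mulKf ?unit_circle_neq0.
Qed.

(** A rotation of x that left E would be accompanied by all nearby rotations,
among which some are by elements of G. *)
Lemma rotation_invariant_dense (G E : set R[i]) :
    circle_subgroup G -> infinite_set G ->
    (forall g z, G g -> E z -> E (g * z)) ->
    (forall z, ~ E z -> exists2 e : R, 0 < e & forall x, nr (z - x) < e -> ~ E x) ->
  rotation_invariant E.
Proof.
move=> GC Ginf GE Eopen; apply: rotation_invariantI => z x z1 Ex.
apply: contrapT => /Eopen[e e0 eE].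
have x0 : 0 < nr x + 1 by rewrite ltr_wpDl// nr_ge0.
have [g Gg gz] := infinite_circle_subgroup_dense GC Ginf z1 (divr_gt0 e0 x0).
apply: (eE (g * x)); last exact: GE.
rewrite -mulrBl nrM nrBC.
apply: (@le_lt_trans _ _ (nr (g - z) * (nr x + 1))); last by rewrite -ltr_pdivlMr.
by rewrite ler_wpM2l ?nr_ge0// lerDl.
Qed.

Lemma connected_rotation (C : set R[i]) z :
  connected C -> connected [set z * x | x in C].
Proof.
move=> cC; apply: connected_continuous_connected => //.
apply: continuous_subspaceT; exact: (@scaler_continuous _ (R[i] : normedModType R[i])).
Qed.

(** Rotations by z and by its inverse both map connected subsets of D to
connected subsets of D. *)
Lemma component_rotation (D : set R[i]) z x :
    rotation_invariant D -> unit_circle z -> D x ->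
  [set z * y | y in connected_component D x] = connected_component D (z * x).
Proof.
have sub z' x' : rotation_invariant D -> unit_circle z' -> D x' ->
    [set z' * y | y in connected_component D x'] `<=` connected_component D (z' * x').
  move=> Dinv z1 Dx; apply: connected_component_max.
  - by exists x' => //; exact: connected_component_refl.
  - move=> _ [y /connected_component_sub Dy <-].
    exact: (rotation_invariantE Dinv z1 Dy).
  - by apply: connected_rotation; exact: component_connected.
move=> Dinv z1 Dx; apply/seteqP; split=> [|y Dy]; first exact: sub.
have z0 := unit_circle_neq0 z1.
exists (z^-1 * y); last by rewrite mulVKf.
have := sub z^-1 (z * x) Dinv (unit_circleV z1) (rotation_invariantE Dinv z1 Dx).
by rewrite mulKf//; apply; exists y.
Qed.

End RotationInvariance.

Section Intertwining.
Context {R : realType} {V : normedModType R[i]}.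
Implicit Types (T A : 'L(V)).

(** The unimodular g such that T is similar to g T. *)
Definition intertwining_factors T : set R[i] :=
  [set g | unit_circle g /\ exists2 A, invertible A & T * A = g *: (A * T)].

Lemma blop_scalerAl a (A B : 'L(V)) : (a *: A) * B = a *: (A * B).
Proof. exact: blop_ext. Qed.

Lemma blop_scalerAr a (A B : 'L(V)) : A * (a *: B) = a *: (A * B).
Proof. by apply: blop_ext => x; exact: blopZ. Qed.

Lemma invertible1 : invertible (1 : 'L(V)).
Proof. by exists 1; split; rewrite mul1r. Qed.

Lemma invertibleZ a A : a != 0 -> invertible A -> invertible (a *: A).
Proof.
move=> a0 [A' [AA' A'A]]; exists (a^-1 *: A'); split.
  by rewrite blop_scalerAl blop_scalerAr scalerA divff// scale1r.
by rewrite blop_scalerAl blop_scalerAr scalerA mulVf// scale1r.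
Qed.

(** Intertwiners multiply and invert like their factors. *)
Lemma circle_subgroup_factors T : circle_subgroup (intertwining_factors T).
Proof.
split=> [g []//||g h [g1 [A iA TA]] [h1 [B [B' [BB' B'B]] TB]]].
  split; first by rewrite /unit_circle /= normr1.
  by exists 1; [exact: invertible1|rewrite mulr1 mul1r scale1r].
split; first by rewrite /unit_circle /= normrM normfV g1 h1 invr1 mulr1.
have h0 := unit_circle_neq0 h1.
have TB' : T * B' = h^-1 *: (B' * T).
  have : B' * (T * B) * B' = h *: (T * B').
    by rewrite TB blop_scalerAr blop_scalerAl mulrA B'B mul1r.
  rewrite -(mulrA B') -(mulrA T) BB' mulr1 => ->.
  by rewrite scalerA mulVf// scale1r.
exists (A * B'); first by apply: invertibleM => //; exists B.
by rewrite mulrA TA blop_scalerAl -mulrA TB' blop_scalerAr scalerA mulrA.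
Qed.

(** From T A = g A T one gets (g z - T) A = g A (z - T). *)
Lemma pencil_rotation T g z :
  intertwining_factors T g -> equivalent (pencil (g * z) T) (pencil z T).
Proof.
move=> [g1 [A iA TA]]; have [A' [AA' A'A]] := iA.
exists (g *: A), A'; split=> //.
- by apply: invertibleZ => //; exact: unit_circle_neq0.
- by exists A.
rewrite blop_scalerAl mulrBr blop_scalerAr mulr1 scalerBr scalerA -TA.
by rewrite mulrBl -mulrA AA' mulr1 blop_scalerAl AA'.
Qed.

(** The factors of T form an infinite, hence dense, subgroup of the circle,
and each of them preserves the set; the set is closed because P is open. *)
Lemma rotation_invariant_pencil (P : 'L(V) -> Prop) T :
    norm_open P -> equivalence_invariant P ->
    infinite_set (intertwining_factors T) ->
  rotation_invariant [set z | ~ P (pencil z T)].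
Proof.
move=> oP eP inf; have GC := circle_subgroup_factors T.
apply: (rotation_invariant_dense GC inf) => [g z Gg nPz Pgz|z /contrapT Pz].
  have GV : intertwining_factors T g^-1.
    by have [_ G1 GV] := GC; rewrite -div1r; exact: GV.
  apply: nPz; apply: eP Pgz.
  rewrite -[in X in equivalent X](mulKf (unit_circle_neq0 Gg.1) z).
  exact: pencil_rotation.
have [e e0 eP'] := oP _ Pz; exists e => // x zx; apply; apply: eP'.
apply: le_lt_trans zx; apply: nr_blop_le; first exact: nr_ge0.
move=> y; rewrite [X in nr X](_ : _ = (z - x) *: y) ?nrZ//.
have -> : (pencil z T - pencil x T) y = (z *: y - T y) - (x *: y - T y) by [].
by rewrite scalerBl opprB addrA subrK.
Qed.

End Intertwining.

Section Adjoint.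
Context {R : realType} {V : normedModType R[i]}.
Implicit Types (T A : 'L(V)).

Lemma adjointM (A B : 'L(V)) : adjoint (A * B) = adjoint B * adjoint A.
Proof. by apply: blop_ext => phi; exact: blop_ext. Qed.

Lemma adjoint1 : adjoint (1 : 'L(V)) = 1.
Proof. by apply: blop_ext => phi; exact: blop_ext. Qed.

Lemma adjointZ a (A : 'L(V)) : adjoint (a *: A) = a *: adjoint A.
Proof. by apply: blop_ext => phi; apply: blop_ext => x; exact: blopZ. Qed.

(** Taking adjoints reverses products, so if A intertwines T with g T then the
adjoint of the inverse of A does the same for the adjoint of T. *)
Lemma intertwining_factors_adjoint T :
  intertwining_factors T `<=` intertwining_factors (adjoint T).
Proof.
move=> g [g1 [A [A' [AA' A'A]] TA]]; split=> //.
have aAA' : adjoint A * adjoint A' = 1 by rewrite -adjointM A'A adjoint1.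
have aA'A : adjoint A' * adjoint A = 1 by rewrite -adjointM AA' adjoint1.
exists (adjoint A'); first by exists (adjoint A).
have : adjoint A * adjoint T = g *: (adjoint T * adjoint A).
  by rewrite -!adjointM TA adjointZ.
move=> /(congr1 (fun S => adjoint A' * S * adjoint A')).
rewrite mulrA aA'A mul1r => ->.
by rewrite blop_scalerAr blop_scalerAl -!mulrA aAA' mulr1.
Qed.

End Adjoint.

Section RotationLikeFactors.
Context {R : realType} {V : normedModType R[i]}.
Implicit Types (U w A : 'L(V)).

(** As w commutes with A, T A = w U A = gamma w A U = gamma A T for T = w U. *)
Lemma gamma_intertwining U w A : invertible U -> commutant (rotated U) w ->
  rotated U A -> invertible A -> intertwining_factors (w * U) (gamma U A).
Proof.
move=> iU wU rA iA; have [_ exf] := rA.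
have [g1 UA] : rotation_factor U A (gamma U A) by exact: xgetPex.
split=> //; exists A => //.
have [_ VU] : inverse_of U (opinv U) by exact: xgetPex.
have {}UA : U * A = gamma U A *: (A * U).
  by rewrite -blop_scalerAl -UA -!mulrA VU mulr1.
by rewrite -mulrA UA blop_scalerAr !mulrA wU.
Qed.

Lemma infinite_powers (G : set R[i]) g : circle_subgroup G -> G g ->
  ~ is_root_of_unity g -> infinite_set G.
Proof.
move=> [GC G1 GV] Gg nroot finG; apply: infinite_nat.
have g0 := unit_circle_neq0 (GC g Gg).
have GM x y : G x -> G y -> G (x * y).
  move=> Gx Gy; rewrite -[y]invrK; apply: (GV _ _ Gx).
  by rewrite -div1r; exact: GV.
have Gexp n : G (g ^+ n) by elim: n => [//|n IH]; rewrite exprS; exact: GM.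
have inj i j : (i < j)%N -> g ^+ i <> g ^+ j.
  move=> ij gij; apply: nroot; exists (j - i)%N; first by rewrite subn_gt0.
  rewrite unity_rootE; apply/eqP; apply: (mulfI (expf_neq0 i g0)).
  by rewrite -exprD subnKC ?(ltnW ij)// mulr1.
apply: (@sub_finite_set _ _ ((fun z => xget 0%N [set n | g ^+ n = z]) @` G)).
  move=> n _; exists (g ^+ n); first exact: Gexp.
  have /= : [set m | g ^+ m = g ^+ n] (xget 0%N [set m | g ^+ m = g ^+ n]).
    by apply: xgetPex; exists n.
  move: (xget _ _) => m mn; have [/inj//|/inj nm|//] := ltngtP m n.
  by case: nm.
exact: finite_image.
Qed.

(** In the first case the generators of the infinite group Gamma, hence all of
Gamma, are factors of T; in the second the powers of one factor are pairwise
distinct. *)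
Lemma infinite_intertwining_factors U w :
    rotation_like U -> commutant (rotated U) w ->
    ((forall A, rotated U A -> invertible A) /\ infinite_set (Gamma U)) \/
    (exists A, [/\ rotated U A, invertible A & ~ is_root_of_unity (gamma U A)]) ->
  infinite_set (intertwining_factors (w * U)).
Proof.
move=> [iU _] wU; have GC := circle_subgroup_factors (w * U).
move=> [[allinv infG]|[A [rA iA nroot]]].
  have Delta_sub : Delta U `<=` intertwining_factors (w * U).
    by move=> _ [A rA <-]; apply: gamma_intertwining => //; exact: allinv.
  by apply: contra_not infG; apply: sub_finite_set; exact: smallest_sub Delta_sub.
exact: infinite_powers GC (gamma_intertwining iU wU rA iA) nroot.
Qed.

(** This set is defined from the spectrum and the first essential spectrum by
topological means only, and rotations permute the components. *)
Lemma rotation_invariant_ess_spectrum5 (S : 'L(V)) :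
  rotation_invariant (spectrum S) -> rotation_invariant (ess_spectrum1 S) ->
  rotation_invariant (ess_spectrum5 S).
Proof.
move=> inv inv1; apply: rotation_invariantI => z x z1 [Sx nC].
split; first exact: (rotation_invariantE inv z1 Sx).
move=> [_ [[y Dy ->] Cx [r [Cr rr]]]]; apply: nC.
have Dinv := rotation_invariantC inv1; have zV := unit_circleV z1.
have z0 := unit_circle_neq0 z1.
exists (connected_component (~` ess_spectrum1 S) (z^-1 * y)).
rewrite -(component_rotation Dinv zV Dy); split.
- exists (z^-1 * y); first exact: (rotation_invariantE Dinv zV Dy).
  exact: component_rotation.
- by exists (z * x) => //; rewrite mulKf.
- exists (z^-1 * r); split; first by exists r.
  exact: (rotation_invariantE (rotation_invariantC inv) zV rr).
Qed.

End RotationLikeFactors.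

Theorem corollary3p7 (R : realType) (X : completeNormedModType R[i])
    (U w : 'L(X)) (hU : rotation_like U) (hw : commutant (rotated U) w)
    (hcond :
      ((forall A, rotated U A -> invertible A) /\ infinite_set (Gamma U)) \/
      (exists A, [/\ rotated U A, invertible A & ~ is_root_of_unity (gamma U A)])) :
  rotation_invariant (spectrum (w * U)) /\
  rotation_invariant (ess_spectrum1 (w * U)) /\
  rotation_invariant (ess_spectrum2 (w * U)) /\
  rotation_invariant (ess_spectrum3 (w * U)) /\
  rotation_invariant (ess_spectrum4 (w * U)) /\
  rotation_invariant (ess_spectrum5 (w * U)) /\
  rotation_invariant (ess_spectrum2 (adjoint (w * U))).
Proof.
have bX : banach X := @complete_banach R X.
have bX' : banach (dual_space X) := blop_banach (@complex_banach R).
have inf := infinite_intertwining_factors hU hw hcond.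
have inf' : infinite_set (intertwining_factors (adjoint (w * U))).
  exact: contra_not (sub_finite_set (@intertwining_factors_adjoint _ _ _)) inf.
have inv : rotation_invariant (spectrum (w * U)).
  by apply: rotation_invariant_pencil inf;
    [exact: norm_open_invertible|exact: invertible_invariant].
have inv1 : rotation_invariant (ess_spectrum1 (w * U)).
  by apply: rotation_invariant_pencil inf;
    [exact: norm_open_semi_fredholm|exact: semi_fredholm_invariant].
split=> //; split=> //; split; last split; last split; last split.
- by apply: rotation_invariant_pencil inf;
    [exact: norm_open_upper|exact: upper_semi_fredholm_invariant].
- by apply: rotation_invariant_pencil inf;
    [exact: norm_open_fredholm|exact: fredholm_invariant].
- by apply: rotation_invariant_pencil inf; [exact: norm_open_weyl|exact: weyl_invariant].
- exact: rotation_invariant_ess_spectrum5.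
- by apply: rotation_invariant_pencil inf';
    [exact: norm_open_upper|exact: upper_semi_fredholm_invariant].
Qed.
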